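(* Let $(V,E)$ be an unrooted directed tree, let $\mu=(\mu_v)_{v\in V}$ be a weight on $V$, and let $\mathcal{F}$ be a Furstenberg family on $\mathbb{N}_0$. Let $X=\ell^p(V,\mu)$, $1\leq p<+\infty$, or $X=c_0(V,\mu)$, and suppose that the backward shift $B$ is a bounded operator on $X$. The following assertions are equivalent: (1) $B$ is $\widetilde{\mathcal{F}}$-transitive. (2) $B$ is $\mathcal{F}$-transitive. (3) For every $N\in\mathbb{N}$ and every finite subset $F\subset V$, we have $I(F,N)\cap J(F,N)\in\mathcal{F}$, where $$I(F,N):=\begin{cases}\bigcap_{v\in F}\Big\{n\in\mathbb{N}_0:\ \sup_{u\in\mathrm{Chi}^n(v)}\frac{1}{|\mu_u|}>N\Big\} & \text{if } X=\ell^1(V,\mu);\\[2mm] \bigcap_{v\in F}\Big\{n\in\mathbb{N}_0:\ \Big(\sum_{u\in\mathrm{Chi}^n(v)}\frac{1}{|\mu_u|^{p^\ast}}\Big)^{1/p^\ast}>N\Big\} & \text{if } X=\ell^p(V,\mu),\ 1<p<+\infty;\\[2mm] \bigcap_{v\in F}\Big\{n\in\mathbb{N}_0:\ \sum_{u\in\mathrm{Chi}^n(v)}\frac{1}{|\mu_u|}>N\Big\} & \text{if } X=c_0(V,\mu);\end{cases}$$ and $$J(F,N):=\begin{cases}\bigcap_{v\in F}\Big\{n\in\mathbb{N}_0:\ \min\big(|\mu_{\mathrm{par}^n(v)}|,\inf_{u\in\mathrm{Chi}^n(\mathrm{par}^n(v))}|\mu_u|\big)<\frac1N\Big\} & \text{if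 } X=\ell^1(V,\mu);\\[2mm] \bigcap_{v\in F}\Big\{n\in\mathbb{N}_0:\ \frac{1}{|\mu_{\mathrm{par}^n(v)}|^{p^\ast}}+\sum_{u\in\mathrm{Chi}^n(\mathrm{par}^n(v))}\frac{1}{|\mu_u|^{p^\ast}}>N^{p^\ast}\Big\} & \text{if } X=\ell^p(V,\mu),\ 1<p<+\infty;\\[2mm] \bigcap_{v\in F}\Big\{n\in\mathbb{N}_0:\ \frac{1}{|\mu_{\mathrm{par}^n(v)}|}+\sum_{u\in\mathrm{Chi}^n(\mathrm{par}^n(v))}\frac{1}{|\mu_u|}>N\Big\} & \text{if } X=c_0(V,\mu).\end{cases}$$ If $\mathcal{F}$ satisfies that $A\cap[n,+\infty[\,\in\mathcal{F}$ whenever $A\in\mathcal{F}$ and $n\in\mathbb{N}$, then conditions (1)-(3) are equivalent to: (4) $B$ is topologically $\mathcal{F}$-recurrent.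
   Context: $\mathbb{N}_0=\{0,1,2,\ldots\}$, $\mathbb{N}=\mathbb{N}_0\setminus\{0\}$, $\mathbb{K}$ is $\mathbb{R}$ or $\mathbb{C}$. Directed tree: a pair $(V,E)$ with $V$ a non-empty countable set (vertices) and $E\subset\{(u,v):u,v\in V,u\neq v\}$ (edges) such that: (i) any two distinct vertices are joined by an undirected path; (ii) there is no circuit, i.e. no sequence $v_1,\ldots,v_n$ of distinct vertices, $n\geq2$, with $(v_j,v_{j+1})\in E$ for $1\le j<n$ and $(v_n,v_1)\in E$; (iii) for each $v\in V$ there is at most one $u\in V$ with $(u,v)\in E$; if it exists it is called the parent of $v$, denoted $\mathrm{par}(v)$. A root is a vertex without parent; the tree is unrooted if it has no root, and then $\mathrm{par}^n(v)$ denotes the $n$-fold iterate of $\mathrm{par}$ at $v$ ($\mathrm{par}^0(v)=v$). $\mathrm{Chi}(v)=\{u\in V:\mathrm{par}(u)=v\}$, $\mathrm{Chi}^0(v)=\{v\}$, $\mathrm{Chi}^1(v)=\mathrm{Chi}(v)$, $\mathrm{Chi}^n(v)=\bigcup_{u\in\mathrm{Chi}(v)}\mathrm{Chi}^{n-1}(u)$ for $n\geq2$. Weight on $V$: a family $\mu=(\mu_v)_{v\in V}$ of non-zero numbers in $\mathbb{K}$. $\ell^p(V,\mu)=\{f\in\mathbb{K}^V:\|f\|_{p,\mu}^p=\sum_{v}|f(v)\mu_v|^p<+\infty\}$ with norm $\|\cdot\|_{p,\mu}$; $c_0(V,\mu)$ is the set of $f\in\mathbb{K}^V$ such that for every $\varepsilon>0$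 there is a finite $F\subset V$ with $|f(v)\mu_v|<\varepsilon$ for all $v\in V\setminus F$, with norm $\sup_v|f(v)\mu_v|$. For $1<p<\infty$, $p^\ast=p/(p-1)$. The backward shift is $(Bf)(v)=\sum_{u\in\mathrm{Chi}(v)}f(u)$. An empty sum is $0$, the supremum of the empty set is $0$; sums of non-negative numbers and suprema may equal $+\infty$. Furstenberg family on $\mathbb{N}_0$: a non-empty family $\mathcal{F}$ of infinite subsets of $\mathbb{N}_0$ such that $A\in\mathcal{F}$, $A\subset A'\subset\mathbb{N}_0$ imply $A'\in\mathcal{F}$. $\widetilde{\mathcal{F}}$ is the family of $A\subset\mathbb{N}_0$ such that for every $N\in\mathbb{N}_0$ there is $D\in\mathcal{F}$ with $(D+\{-N,\ldots,N\})\cap\mathbb{N}_0\subset A$. For nonempty open $U,W\subset X$, $N(U,W)=\{n\in\mathbb{N}_0:B^n(U)\cap W\neq\emptyset\}$. For a family $\mathcal{G}$ of subsets of $\mathbb{N}_0$, $B$ is $\mathcal{G}$-transitive if $N(U,W)\in\mathcal{G}$ for all nonempty open $U,W\subset X$, and topologically $\mathcal{G}$-recurrent if $N(U,U)\in\mathcal{G}$ for all nonempty open $U\subset X$. Intersections over $F=\emptyset$ are $\mathbb{N}_0$. *)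

(* Defs.v *)
From HB Require Import structures.
From mathcomp Require Import all_boot all_order all_algebra.
From mathcomp Require Import complex.
From mathcomp Require Import all_classical all_reals all_analysis.

Set Implicit Arguments.
Unset Strict Implicit.
Unset Printing Implicit Defensive.
Import Order.TTheory GRing.Theory Num.Theory.

Local Open Scope classical_set_scope.
Local Open Scope ring_scope.

(* The scalar field is R or C; the modulus is always valued in R. *)
Inductive scalar_kind := RealScalars | ComplexScalars.

Definition scalars (R : realType) (k : scalar_kind) : numFieldType :=
  match k with RealScalars => R | ComplexScalars => R[i] end.

Definition modulus (R : realType) (k : scalar_kind) : scalars R k -> R :=
  match k return scalars R k -> R with
  | RealScalars => fun x : R => `|x|
  | ComplexScalars => fun z : R[i] => complex.Re `|z|
  end.

Section directed_trees.
Variables (V : countType) (E : rel V).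

Record directed_tree : Prop := DirectedTree {
  tree_nonempty : [set: V] !=set0 ;
  tree_irrefl : forall u v, E u v -> u != v ;
  tree_connected : forall u v, u != v ->
    exists2 s : seq V, path (fun x y => E x y || E y x) u s & last u s = v ;
  tree_nocircuit : forall s : seq V, (2 <= size s)%N -> uniq s -> ~~ cycle E s ;
  tree_parent : forall u u' v, E u v -> E u' v -> u = u' }.

Definition unrooted := forall v, exists u, E u v.

(* The parent of v; the value v at a root is a dummy. *)
Definition par (v : V) : V := xget v [set u | E u v].

(* Not [set u | par u = v], because of the dummy value of par at a root. *)
Definition Chi (v : V) : set V := [set u | E v u].

Fixpoint Chin (n : nat) (v : V) : set V :=
  if n is n'.+1 then \bigcup_(u in Chi v) Chin n' u else [set v].

End directed_trees.

Definition Furstenberg (F : set (set nat)) : Prop :=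
  [/\ F !=set0, (forall A, F A -> infinite_set A)
    & forall A A', F A -> A `<=` A' -> F A'].

Definition Ftilde (F : set (set nat)) : set (set nat) :=
  [set A | forall N : nat, exists2 D, F D &
    [set m : nat | exists d (j : int),
       [/\ D d, - N%:Z <= j <= N%:Z & m%:Z = d%:Z + j]] `<=` A].

(* Unordered (unconditional) summation: the sum is the limit of the finite
   partial sums, directed by inclusion. *)
Section unordered_sums.
Variables (R : realType) (k : scalar_kind) (V : choiceType).
Implicit Types (A : set V) (f : V -> scalars R k).

Definition has_sum A f (s : scalars R k) : Prop :=
  forall e : R, 0 < e -> exists2 F0, fsets A F0 &
    forall F, fsets A F -> F0 `<=` F -> modulus (\sum_(u \in F) f u - s) < e.

Definition sum_over A f : scalars R k := xget 0 [set s | has_sum A f s].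

End unordered_sums.

Inductive space_kind (R : realType) := ell of R | c0.
Arguments c0 {R}.

Definition admissible (R : realType) (X : space_kind R) : Prop :=
  if X is ell p then 1 <= p else True.

Section weighted_spaces.
Variables (R : realType) (k : scalar_kind) (V : countType).
Variable mu : V -> scalars R k.
Variable X : space_kind R.
Implicit Types f g : V -> scalars R k.

Definition is_weight := forall v, mu v != 0.

Definition space : set (V -> scalars R k) :=
  match X with
  | ell p =>
      [set f | (\esum_(v in [set: V]) (modulus (f v * mu v) `^ p)%:E < +oo)%E]
  | c0 =>
      [set f | forall e : R, 0 < e -> exists2 F, finite_set F &
                 forall v, ~ F v -> modulus (f v * mu v) < e]
  end.

(* Finite on [space]. *)
Definition wnorm f : \bar R :=
  match X with
  | ell p => ((\esum_(v in [set: V]) (modulus (f v * mu v) `^ p)%:E) `^ p^-1)%E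
  | c0 => ereal_sup [set (modulus (f v * mu v))%:E | v in [set: V]]
  end.

Definition open_in_space (U : set (V -> scalars R k)) : Prop :=
  U `<=` space /\
  forall f, U f -> exists2 e : R, 0 < e &
    forall g, space g -> (wnorm (fun v => (g v - f v)%R) < e%:E)%E -> U g.

Section operators.
Variable T : (V -> scalars R k) -> (V -> scalars R k).

Definition return_set (U W : set (V -> scalars R k)) : set nat :=
  [set n | (iter n T @` U) `&` W !=set0].

Definition transitive_for (G : set (set nat)) : Prop :=
  forall U W, open_in_space U -> U !=set0 -> open_in_space W -> W !=set0 ->
    G (return_set U W).

Definition recurrent_for (G : set (set nat)) : Prop :=
  forall U, open_in_space U -> U !=set0 -> G (return_set U U).

End operators.

Variable E : rel V.

Definition Bshift f : V -> scalars R k := fun v => sum_over (Chi E v) f.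

(* Convergence of the defining sums is part of B being an operator on X. *)
Definition Bshift_bounded : Prop :=
  (forall f, space f ->
     (forall v, exists s, has_sum (Chi E v) f s) /\ space (Bshift f)) /\
  exists C : R, forall f, space f -> (wnorm (Bshift f) <= C%:E * wnorm f)%E.

End weighted_spaces.

Definition conj_exp (R : realType) (p : R) : R := p / (p - 1).

(* Supremum of a set of nonnegative numbers, with value 0 on the empty set
   (the library's ereal_sup has value -oo there). *)
Definition esup0 (R : realType) (A : set (\bar R)) : \bar R :=
  ereal_sup (0%E |` A).

Section index_sets.
Variables (R : realType) (k : scalar_kind) (V : countType) (E : rel V).
Variable mu : V -> scalars R k.
Variable X : space_kind R.

Local Notation absmu u := (modulus (mu u)).

Definition Iset (F : set V) (N : nat) : set nat :=
  \bigcap_(v in F) [set n |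
    match X with
    | ell p =>
        if p == 1 then
          (N%:R%:E < esup0 [set (absmu u)^-1%:E | u in Chin E n v])%E
        else
          (N%:R%:E < (\esum_(u in Chin E n v) ((absmu u `^ conj_exp p)^-1)%:E)
                       `^ (conj_exp p)^-1)%E
    | c0 => (N%:R%:E < \esum_(u in Chin E n v) ((absmu u)^-1)%:E)%E
    end].

Definition Jset (F : set V) (N : nat) : set nat :=
  \bigcap_(v in F) [set n |
    let w := iter n (par E) v in
    match X with
    | ell p =>
        if p == 1 then
          (Order.min (absmu w)%:E
             (ereal_inf [set (absmu u)%:E | u in Chin E n w])
           < (N%:R^-1)%:E)%E
        else
          ((N%:R `^ conj_exp p)%:E <
           ((absmu w `^ conj_exp p)^-1)%:E +
           \esum_(u in Chin E n w) ((absmu u `^ conj_exp p)^-1)%:E)%E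
    | c0 =>
        (N%:R%:E <
         ((absmu w)^-1)%:E + \esum_(u in Chin E n w) ((absmu u)^-1)%:E)%E
    end].

End index_sets.

(* Main.v *)
(* All conditions only involve finitely supported vectors, since these are dense
   and B maps delta_u to delta_(par u).  By Hölder's inequality and its equality
   case, n in I({v}, N) means, up to constants, that delta_v is the image under
   B^n of a vector of norm < 1/N supported in Chi^n(v), and n in J({v}, N) that
   some vector close to delta_v has a small image under B^n: delta_v itself if
   |mu_w| is small at w = par^n(v), and otherwise the difference of delta_v and a
   small vector supported in Chi^n(w) with the same image delta_w.  This gives an
   orbit from any U to any W, and, as the sets I(F, N) and J(F, N) decrease in
   (F, N), from finitely many pairs (U, W) at the same time; applied to the
   preimages under B^j this yields (1).  Conversely, if f is close to the
   indicator 1_F and B^n f is close to -1_F, then f - 1_F is a small vector whose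
   sum over Chi^n(v) cannot be small, nor can its sum over Chi^n(w) unless |mu_w|
   is small.  For recurrence, -1_F is replaced with 1_F; this works once n is so
   large that par^n maps no point of F into F. *)

Require Import Defs.
From HB Require Import structures.
From mathcomp Require Import all_boot all_order all_algebra.
From mathcomp Require Import complex finmap ring lra.
From mathcomp Require Import all_classical all_reals all_analysis.

Set Implicit Arguments.
Unset Strict Implicit.
Unset Printing Implicit Defensive.
Import Order.TTheory GRing.Theory Num.Theory.

Local Open Scope classical_set_scope.
Local Open Scope ring_scope.

Local Notation space := Defs.space.

(** * Modulus, powers and finite sums *)

Section modulus.
Variables (R : realType) (k : scalar_kind).
Implicit Types (x y : scalars R k) (a b : R).

(** Embedding the reals treats both scalar fields at once: [emb] is injective, reflects the order
    and turns [modulus] into the norm, so the properties of the norm pass to [modulus]. *)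
Definition emb : R -> scalars R k :=
  match k return R -> scalars R k with
  | RealScalars => fun a : R => a
  | ComplexScalars => fun a : R => (a%:C)%C
  end.

Lemma emb_modulus x : emb (modulus x) = `|x|.
Proof. by rewrite /emb /modulus; case: k x => //= x; rewrite normc_def. Qed.

Lemma ler_emb a b : (emb a <= emb b) = (a <= b).
Proof. by rewrite /emb; case: k => //=; rewrite lecR. Qed.

Lemma emb_inj : injective emb.
Proof. by move=> a b ab; apply/eqP; rewrite eq_le -!ler_emb ab lexx. Qed.

Lemma embD a b : emb (a + b) = emb a + emb b.
Proof. by rewrite /emb; case: k => //=; rewrite rmorphD. Qed.

Lemma embM a b : emb (a * b) = emb a * emb b.
Proof. by rewrite /emb; case: k => //=; rewrite rmorphM. Qed.

Lemma emb0 : emb 0 = 0.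
Proof. by rewrite /emb; case: k. Qed.

Lemma emb1 : emb 1 = 1.
Proof. by rewrite /emb; case: k. Qed.

Lemma emb_sum (I : Type) (s : seq I) (P : pred I) (g : I -> R) :
  emb (\sum_(i <- s | P i) g i) = \sum_(i <- s | P i) emb (g i).
Proof. by rewrite (big_morph emb embD emb0). Qed.

Lemma modulus_ge0 x : 0 <= modulus x.
Proof. by rewrite -ler_emb emb0 emb_modulus. Qed.

Lemma modulusD x y : modulus (x + y) <= modulus x + modulus y.
Proof. by rewrite -ler_emb embD !emb_modulus ler_normD. Qed.

Lemma modulusM x y : modulus (x * y) = modulus x * modulus y.
Proof. by apply: emb_inj; rewrite embM !emb_modulus normrM. Qed.

Lemma modulus0 : modulus (0 : scalars R k) = 0.
Proof. by apply: emb_inj; rewrite emb_modulus emb0 normr0. Qed.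

Lemma modulusN x : modulus (- x) = modulus x.
Proof. by apply: emb_inj; rewrite !emb_modulus normrN. Qed.

Lemma modulus_eq0 x : (modulus x == 0) = (x == 0).
Proof. by rewrite -(inj_eq emb_inj) emb_modulus emb0 normr_eq0. Qed.

Lemma modulus_gt0 x : (0 < modulus x) = (x != 0).
Proof. by rewrite lt0r modulus_ge0 andbT modulus_eq0. Qed.

Lemma modulus_emb a : 0 <= a -> modulus (emb a) = a.
Proof.
by move=> a0; apply: emb_inj; rewrite emb_modulus ger0_norm// -emb0 ler_emb.
Qed.

Lemma modulus1 : modulus (1 : scalars R k) = 1.
Proof. by rewrite -emb1 modulus_emb. Qed.

Lemma modulus_nat n : modulus (n%:R : scalars R k) = n%:R.
Proof.
suff -> : (n%:R : scalars R k) = emb n%:R by rewrite modulus_emb.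
by elim: n => [|n IH]; rewrite ?emb0// -!natr1 embD emb1 IH.
Qed.

Lemma modulusV x : modulus x^-1 = (modulus x)^-1.
Proof.
have [->|x0] := eqVneq x 0; first by rewrite !(invr0, modulus0).
apply: (mulfI (_ : modulus x != 0)); first by rewrite modulus_eq0.
by rewrite -modulusM divff// modulus1 divff// modulus_eq0.
Qed.

Lemma modulusB x y : modulus (x - y) <= modulus x + modulus y.
Proof. by rewrite (le_trans (modulusD _ _))// modulusN. Qed.

Lemma ler_modulusB x y : modulus x - modulus y <= modulus (x - y).
Proof. by rewrite lerBlDr (le_trans _ (modulusD _ _))// subrK. Qed.

Lemma modulus_sum (I : Type) (s : seq I) (P : pred I) (g : I -> scalars R k) :
  modulus (\sum_(i <- s | P i) g i) <= \sum_(i <- s | P i) modulus (g i).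
Proof.
elim/big_ind2: _ => [|? ? ? ? h h'|//]; first by rewrite modulus0.
by rewrite (le_trans (modulusD _ _))// lerD.
Qed.

End modulus.

Section powers.
Variable R : realType.
Implicit Types a b t p q x y : R.

Lemma powR_leq a b p : 0 < p -> 0 <= a -> 0 <= b ->
  (a `^ p <= b `^ p) = (a <= b).
Proof.
move=> p0 a0 b0; have [ab|ba] := leP a b; last first.
  by apply/negbTE; rewrite -ltNge gt0_ltr_powR.
by rewrite ge0_ler_powR// ltW.
Qed.

Lemma powRKV a p : 0 < p -> 0 <= a -> (a `^ p^-1) `^ p = a.
Proof. by move=> p0 a0; rewrite -powRrM mulVf ?gt_eqF// powRr1. Qed.

Lemma powRV a p : 0 <= a -> a^-1 `^ p = (a `^ p)^-1.
Proof. by move=> a0; rewrite -powR_inv1// -powRrM mulN1r powRN. Qed.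

Lemma poweR_inv_le (z : \bar R) b p : 0 < p -> 0 <= b -> (0 <= z)%E ->
  (z `^ p^-1 <= b%:E)%E = (z <= (b `^ p)%:E)%E.
Proof.
move=> p0 b0; case: z => [a|_|//]; last by rewrite poweRyr ?invr_neq0 ?gt_eqF.
rewrite !lee_fin => a0; rewrite -(@powR_leq _ _ p)// ?powR_ge0//.
by rewrite powRKV.
Qed.

Lemma poweR_inv_gt (z : \bar R) b p : 0 < p -> 0 <= b -> (0 <= z)%E ->
  (b%:E < z `^ p^-1)%E = ((b `^ p)%:E < z)%E.
Proof. by move=> p0 b0 z0; rewrite !ltNge poweR_inv_le. Qed.

Lemma powR_convex p t x y : 1 <= p -> 0 <= t <= 1 -> 0 <= x -> 0 <= y ->
  (t * x + (1 - t) * y) `^ p <= t * x `^ p + (1 - t) * y `^ p.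
Proof.
move=> p1 /andP[t0 t1] x0 y0.
have := @convex_powR R p p1 (Itv01 t0 t1) x y.
rewrite !inE /= !in_itv /= !andbT => /(_ x0 y0).
by rewrite !convRE.
Qed.

End powers.

Section finite_sums.
Variables (R : realType) (V : choiceType).

(** [esum] is the supremum of the finite partial sums; enumerating finite sets by duplicate-free
    lists makes these ordinary big sums. *)
Lemma esum_leP (A : set V) (a : V -> R) (b : R) :
  (\esum_(v in A) (a v)%:E <= b%:E)%E <->
  (forall s : seq V, uniq s -> {in s, forall v, A v} -> \sum_(v <- s) a v <= b).
Proof.
split=> [h s us sA|h].
  rewrite -lee_fin (le_trans _ h)// -sumEFin esum_ge//.
  by exists [set` s]; [split => // v /= /sA|rewrite -fsbig_seq].
apply: ge_ereal_sup => _ [F [finF FA] <-].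
rewrite fsbig_finite//= sumEFin lee_fin; apply: h => [|v]; first exact: fset_uniq.
by rewrite in_fset_set// inE => /FA.
Qed.

(** A strict lower bound is already exceeded on a finite set. This yields the finite supports in
    [spaceP] and [dual_gt_small]. *)
Lemma esum_gtP (A : set V) (a : V -> R) (b : R) :
  (b%:E < \esum_(v in A) (a v)%:E)%E <->
  (exists s : seq V, [/\ uniq s, {in s, forall v, A v} & b < \sum_(v <- s) a v]).
Proof.
split=> [|[s [us sA bs]]]; last first.
  rewrite ltNge; apply/negP => /esum_leP/(_ s us sA).
  by rewrite leNgt bs.
move=> bA; apply: contrapT => h; move: bA; rewrite ltNge => /negP; apply.
apply/esum_leP => s us sA.
by rewrite leNgt; apply/negP => ?; apply: h; exists s.
Qed.

End finite_sums.

(** * The weighted norms *)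

Section weighted_norm.
Variables (R : realType) (k : scalar_kind) (V : countType).
Variable mu : V -> scalars R k.
Variable X : space_kind R.
Hypothesis admX : admissible X.
Implicit Types (f g : V -> scalars R k) (M N e : R) (a : scalars R k).
Implicit Types s t : seq V.

(* [bnd f M] is the inequality ||f|| <= M, stated through finite sums only. *)
Definition bnd f M : Prop :=
  0 <= M /\
  match X with
  | ell p => forall s, uniq s ->
      \sum_(v <- s) modulus (f v * mu v) `^ p <= M `^ p
  | c0 => forall v, modulus (f v * mu v) <= M
  end.

Definition restr s f : V -> scalars R k := fun v => if v \in s then f v else 0.

Definition delta u : V -> scalars R k := fun v => (v == u)%:R.

Lemma bnd_ge0 f M : bnd f M -> 0 <= M. Proof. by case. Qed.

Lemma admissible_gt0 p : X = ell p -> 0 < p.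
Proof. by move=> Xp; apply: lt_le_trans ltr01 _; move: admX; rewrite Xp. Qed.

Lemma wnorm_leP f M : 0 <= M -> (wnorm mu X f <= M%:E)%E <-> bnd f M.
Proof.
move=> M0; have := admissible_gt0; rewrite /wnorm /bnd.
case: X => [p /(_ p erefl) p0|_].
  rewrite poweR_inv_le ?esum_ge0//; last by move=> v _; rewrite lee_fin powR_ge0.
  split=> [/esum_leP h|[_ h]]; first by split => // s us; exact: h.
  by apply/esum_leP => s us _; exact: h.
split=> [h|[_ h]]; last by apply: ge_ereal_sup => _ [v _ <-]; rewrite lee_fin.
split=> // v; rewrite -lee_fin (le_trans _ h)//.
by apply: ereal_sup_ubound; exists v.
Qed.

Lemma wnorm_ltP f e : 0 < e ->
  (wnorm mu X f < e%:E)%E <-> exists2 M, M < e & bnd f M.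
Proof.
move=> e0; split=> [|[M Me bM]]; last first.
  apply: (@le_lt_trans _ _ M%:E); last by rewrite lte_fin.
  by apply/wnorm_leP => //; case: bM.
case W : (wnorm mu X f) => [M| |]// Me.
(* [bnd] asks for a non-negative bound, hence the maximum. The value -oo, possible for [c0] over an
   empty [V], is left to the last case. *)
- exists (Num.max 0 M); first by rewrite gt_max e0 -lte_fin.
  by apply/wnorm_leP; rewrite ?W ?lee_fin le_max ?lexx ?orbT.
- by exists 0 => //; apply/wnorm_leP => //; rewrite W leNye.
Qed.

Lemma bnd_le f M N : M <= N -> bnd f M -> bnd f N.
Proof.
move=> MN [M0]; have N0 := le_trans M0 MN; have := admissible_gt0; rewrite /bnd.
case: X => [p /(_ p erefl) p0 h|_ h]; split => //.
  by move=> s /h/le_trans; apply; rewrite powR_leq.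
by move=> v; exact: le_trans (h v) _.
Qed.

Lemma bnd_domM f g M :
  (forall v, modulus (g v * mu v) <= modulus (f v * mu v)) ->
  bnd f M -> bnd g M.
Proof.
move=> gfmu [M0]; have := admissible_gt0; rewrite /bnd.
case: X => [p /(_ p erefl) p0 h|_ h]; split => //.
  move=> s /h; apply: le_trans; apply: ler_sum => v _.
  by rewrite powR_leq// modulus_ge0.
by move=> v; exact: le_trans (gfmu v) _.
Qed.

(** The norm sees only moduli. This is also how bounds pass between pointwise equal vectors without
    rewriting functions. *)
Lemma bnd_dom f g M : (forall v, modulus (g v) <= modulus (f v)) ->
  bnd f M -> bnd g M.
Proof.
move=> gf; apply: bnd_domM => v.
by rewrite !modulusM ler_wpM2r// modulus_ge0.
Qed.

Lemma bnd_coord f M v : bnd f M -> modulus (f v) * modulus (mu v) <= M.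
Proof.
rewrite -modulusM => -[M0]; have := admissible_gt0; rewrite /bnd.
case: X => [p /(_ p erefl) p0 /(_ [:: v] erefl)|_]//.
by rewrite big_seq1 powR_leq// modulus_ge0.
Qed.

Lemma bnd0 f : (forall v, f v = 0) -> bnd f 0.
Proof.
move=> f0; have := admissible_gt0; rewrite /bnd.
case: X => [p /(_ p erefl) p0|_]; split => //.
  move=> s _; rewrite powR0 ?gt_eqF// big1// => v _.
  by rewrite f0 mul0r modulus0 powR0 ?gt_eqF.
by move=> v; rewrite f0 mul0r modulus0.
Qed.

Lemma bndZ a f M : bnd f M -> bnd (fun v => a * f v) (modulus a * M).
Proof.
move=> [M0]; have a0 := modulus_ge0 a; have := admissible_gt0; rewrite /bnd.
case: X => [p /(_ p erefl) p0 h|_ h]; split; rewrite ?mulr_ge0//.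
  move=> s us; rewrite powRM//.
  under eq_bigr do rewrite -mulrA modulusM powRM ?modulus_ge0//.
  by rewrite -mulr_sumr ler_wpM2l ?powR_ge0// h.
by move=> v; rewrite -mulrA modulusM ler_wpM2l.
Qed.

Lemma bnd_deltaZ a u : bnd (fun v => a * delta u v) (modulus (a * mu u)).
Proof.
rewrite modulusM; apply: bndZ; have m0 := modulus_ge0 (mu u).
have := admissible_gt0; rewrite /bnd /delta.
case: X => [p /(_ p erefl) p0|_]; split => //; last first.
  by move=> v; have [->|_] := eqVneq; rewrite ?mul1r// mul0r modulus0.
move=> s us; have [us'|us'] := boolP (u \in s); last first.
  rewrite big_seq big1 ?powR_ge0// => v vs; have [vu|_] := eqVneq v u.
    by rewrite -vu vs in us'.
  by rewrite mul0r modulus0 powR0// gt_eqF.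
rewrite (bigD1_seq u)//= eqxx mul1r big1 ?addr0// => v /negPf ->.
by rewrite mul0r modulus0 powR0// gt_eqF.
Qed.

(* Minkowski's inequality, from the convexity of [x `^ p]: with t = M / (M + N),
   |f + g| <= (M + N) (t |f| / M + (1 - t) |g| / N). *)
Lemma bndD f g M N : bnd f M -> bnd g N -> bnd (fun v => f v + g v) (M + N).
Proof.
move=> bf bg; have [M0 N0] := (bnd_ge0 bf, bnd_ge0 bg).
have modfg v : modulus ((f v + g v) * mu v) <=
    modulus (f v * mu v) + modulus (g v * mu v).
  by rewrite mulrDl modulusD.
have null h K v : K = 0 -> bnd h K -> h v * mu v = 0.
  move=> -> /bnd_coord -/(_ v); rewrite -modulusM => h0.
  by apply/eqP; rewrite -modulus_eq0 eq_le h0 modulus_ge0.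
(* The convexity argument divides by [M] and [N]. If one of them is 0, the corresponding summand
   vanishes once multiplied by [mu]. *)
have [M1|M1] := eqVneq M 0; last have [N1|N1] := eqVneq N 0.
- rewrite M1 add0r; apply: bnd_domM bg => v; rewrite mulrDl.
  by rewrite [f v * _](null _ _ _ M1 bf) add0r.
- rewrite N1 addr0; apply: bnd_domM bf => v; rewrite mulrDl.
  by rewrite [g v * _](null _ _ _ N1 bg) addr0.
have Mp : 0 < M by rewrite lt0r M1.
have Np : 0 < N by rewrite lt0r N1.
have MNp : 0 < M + N by rewrite addr_gt0.
have := admissible_gt0; move: admX bf bg; rewrite /bnd.
case: X => [p /= p1 [_ hf] [_ hg] /(_ p erefl) p0|_ [_ hf] [_ hg] _]; last first.
  split => [|v]; first by rewrite addr_ge0.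
  by rewrite (le_trans (modfg v))// lerD.
split => [|s us]; first by rewrite addr_ge0.
pose t := M / (M + N).
have t01 : 0 <= t <= 1.
  by rewrite /t divr_ge0 ?(ltW MNp)//= ler_pdivrMr// mul1r lerDl.
have tE : 1 - t = N / (M + N) by rewrite /t; field; rewrite gt_eqF.
have pt v : modulus ((f v + g v) * mu v) `^ p <= (M + N) `^ p *
    (t * (modulus (f v * mu v) `^ p / M `^ p) +
     (1 - t) * (modulus (g v * mu v) `^ p / N `^ p)).
  set x := modulus (f v * mu v); set y := modulus (g v * mu v).
  have [x0 y0] : 0 <= x /\ 0 <= y by rewrite /x /y !modulus_ge0.
  apply: (@le_trans _ _ ((x + y) `^ p)).
    by rewrite powR_leq ?modulus_ge0 ?addr_ge0//; exact: modfg.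
  have -> : x + y = (M + N) * (t * (x / M) + (1 - t) * (y / N)).
    by rewrite tE /t; field; rewrite M1 N1 gt_eqF.
  have xM : 0 <= x / M by rewrite divr_ge0.
  have yN : 0 <= y / N by rewrite divr_ge0.
  case/andP: (t01) => t0 t1.
  have xy0 : 0 <= t * (x / M) + (1 - t) * (y / N).
    by apply: addr_ge0; apply: mulr_ge0 => //; rewrite subr_ge0.
  rewrite powRM ?(ltW MNp)//.
  rewrite ler_wpM2l ?powR_ge0//.
  rewrite (le_trans (powR_convex p1 t01 xM yN))//.
  by rewrite !(powRM _ x0, powRM _ y0) ?invr_ge0// !powRV.
apply: le_trans (ler_sum _ (fun v _ => pt v)) _.
rewrite -mulr_sumr ler_piMr ?powR_ge0// big_split/= -!mulr_sumr -!mulr_suml.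
case/andP: t01 => t0 t1.
apply: (@le_trans _ _ (t * 1 + (1 - t) * 1)); last by rewrite !mulr1 addrC subrK.
by rewrite lerD// ler_wpM2l ?subr_ge0// ler_pdivrMr ?powR_gt0// mul1r ?hf ?hg.
Qed.


Lemma bnd_restr s f : exists M, bnd (restr s f) M.
Proof.
elim: s => [|u s [M IH]]; first by exists 0; apply: bnd0.
have [us|us] := boolP (u \in s).
  exists M; apply: bnd_dom IH => v; rewrite /restr in_cons.
  by have [->|_] := eqVneq v u; rewrite ?us.
exists (modulus (f u * mu u) + M).
apply: bnd_dom (bndD (bnd_deltaZ (f u) u) IH) => v; rewrite /restr /delta in_cons.
have [->|_] := eqVneq v u; first by rewrite (negPf us) mulr1 addr0.
by rewrite mulr0 add0r.
Qed.

Definition off s f : V -> scalars R k := fun v => if v \in s then 0 else f v.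

Lemma restr_off s f v : restr s f v + off s f v = f v.
Proof. by rewrite /restr /off; case: ifP; rewrite ?addr0 ?add0r. Qed.

Lemma bnd_off s t f M : {subset s <= t} -> bnd (off s f) M -> bnd (off t f) M.
Proof.
move=> st; apply: bnd_dom => v; rewrite /off; case: ifPn => [_|vt].
  by rewrite modulus0 modulus_ge0.
by rewrite (negPf (contra (@st v) vt)).
Qed.

Lemma bnd_of_off s f M : bnd (off s f) M -> exists N, bnd f N.
Proof.
have [K bK] := bnd_restr s f => /(bndD bK) b; exists (K + M).
by apply: bnd_dom b => v; rewrite restr_off.
Qed.

(** Small tails outside finite sets characterise membership for both kinds of space, so later
    arguments need not distinguish them. *)
Lemma spaceP f :
  space mu X f <-> forall e, 0 < e -> exists s, bnd (off s f) e.
Proof.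
have bnd_fin : (exists M, bnd f M) -> forall p, X = ell p ->
    (\esum_(v in [set: V]) (modulus (f v * mu v) `^ p)%:E < +oo)%E.
  move=> [M [M0 b]] p Xp; apply: (@le_lt_trans _ _ (M `^ p)%:E); last exact: ltry.
  by apply/esum_leP => s us _; rewrite Xp in b; exact: b.
have := admissible_gt0; move: bnd_fin (@bnd_of_off); rewrite /Defs.space /bnd.
case: X => [p bf bo /(_ p erefl) p0|_ _ _].
  split=> [|h]; last first.
    (* One tail of finite norm suffices, since the rest of [f] is finitely supported. *)
    by have [s /bo] := h 1 ltr01; move=> /bf/(_ p erefl).
  rewrite /=; set T := esum _ _ => Tfin e e0.
  have T0 : (0 <= T)%E by apply: esum_ge0 => v _; rewrite lee_fin powR_ge0.
  have TE : T = (fine T)%:E by rewrite fineK// ge0_fin_numE.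
  (* The sum over [s] is within [e ^ p] of the total. Adding to [s] the points of any [t] outside
     [s] does not exceed the total, so these points contribute at most [e ^ p]. *)
  have /esum_gtP[s [us _ sT]] : ((fine T - e `^ p)%:E < T)%E.
    by rewrite TE lte_fin ltrBlDr ltrDl powR_gt0.
  exists s; split=> [|t ut]; first exact: ltW.
  have /esum_leP/(_ (s ++ [seq v <- t | v \notin s])) : (T <= (fine T)%:E)%E.
    by rewrite -TE.
  rewrite cat_uniq us filter_uniq// andbT /=.
  have -> : ~~ has [in s] [seq v <- t | v \notin s].
    by apply/hasPn => v; rewrite mem_filter => /andP[].
  move=> /(_ erefl (fun _ _ => I)); rewrite big_cat/= big_filter => sT'.
  suff -> : \sum_(v <- t) modulus (off s f v * mu v) `^ p =
      \sum_(v <- t | v \notin s) modulus (f v * mu v) `^ p by lra.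
  rewrite [RHS]big_mkcond/=; apply: eq_bigr => v _; rewrite /off.
  by case: ifP => //= _; rewrite mul0r modulus0 powR0// gt_eqF.
split=> h e e0.
  have [F /finite_seqP[s ->] sf] := h e e0; exists s; split=> [|v]; first exact: ltW.
  rewrite /off; case: ifPn => [_|/negP vs]; first by rewrite mul0r modulus0 ltW.
  by apply/ltW/sf.
(* Halving [e] turns the weak bound into the strict one in the definition of [c0]. *)
have [s [_ sf]] := h (e / 2) (divr_gt0 e0 (ltr0Sn _ _)).
exists [set` s] => // v /negP vs; apply: (@le_lt_trans _ _ (e / 2)); last by lra.
by have := sf v; rewrite /off (negPf vs).
Qed.

Lemma space_supp s f : (forall v, v \notin s -> f v = 0) -> space mu X f.
Proof.
move=> f0; apply/spaceP => e e0; exists s; apply: bnd_le (ltW e0) _.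
by apply: bnd0 => v; rewrite /off; case: ifPn => // /f0.
Qed.

Lemma space_restr s f : space mu X (restr s f).
Proof. by apply: (@space_supp s) => v /negPf; rewrite /restr => ->. Qed.

Lemma space_delta u : space mu X (delta u).
Proof.
by apply: (@space_supp [:: u]) => v; rewrite inE /delta => /negPf ->.
Qed.

Lemma spaceD f g :
  space mu X f -> space mu X g -> space mu X (fun v => f v + g v).
Proof.
move=> /spaceP hf /spaceP hg; apply/spaceP => e e0.
have e2 : 0 < e / 2 by lra.
have [s bs] := hf _ e2; have [t bt] := hg _ e2; exists (s ++ t).
rewrite (splitr e).
have bs' : bnd (off (s ++ t) f) (e / 2).
  by apply: bnd_off bs => v; rewrite mem_cat => ->.
have bt' : bnd (off (s ++ t) g) (e / 2).
  by apply: bnd_off bt => v; rewrite mem_cat orbC => ->.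
apply: bnd_dom (bndD bs' bt') => v.
by rewrite /off; case: ifP; rewrite ?addr0.
Qed.

Lemma spaceZ a f : space mu X f -> space mu X (fun v => a * f v).
Proof.
move=> /spaceP hf; apply/spaceP => e e0; have a0 := modulus_ge0 a.
have e2 : 0 < e / (modulus a + 1) by rewrite divr_gt0// ltr_wpDl.
have [s /(bndZ a) bs] := hf _ e2; exists s.
apply: bnd_le (_ : modulus a * (e / (modulus a + 1)) <= e) _.
  rewrite mulrA ler_pdivrMr ?ltr_wpDl//; lra.
by apply: bnd_dom bs => v; rewrite /off; case: ifP; rewrite ?mulr0.
Qed.

Lemma bnd_sum s (b : V -> scalars R k) (G : V -> V -> scalars R k) M :
  0 <= M -> {in s, forall u, bnd (G u) M} ->
  bnd (fun v => \sum_(u <- s) b u * G u v) ((\sum_(u <- s) modulus (b u)) * M).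
Proof.
move=> M0; elim: s => [|u s IH] sG.
  by rewrite big_nil mul0r; apply: bnd0 => v; rewrite big_nil.
rewrite big_cons mulrDl.
have /(bndZ (b u)) b1 := sG u (mem_head _ _).
have b2 := IH (fun v vs => sG v (mem_behead (vs : v \in behead (u :: s)))).
by apply: bnd_dom (bndD b1 b2) => v; rewrite big_cons.
Qed.

Lemma space_sum s (b : V -> scalars R k) (G : V -> V -> scalars R k) :
  {in s, forall u, space mu X (G u)} ->
  space mu X (fun v => \sum_(u <- s) b u * G u v).
Proof.
elim: s => [|u s IH] sG.
  by apply: (@space_supp [::]) => v _; rewrite big_nil.
have := spaceD (spaceZ (b u) (sG u (mem_head _ _)))
  (IH (fun v vs => sG v (mem_behead (vs : v \in behead (u :: s))))).
by congr (space _ _ _); apply/funext => v; rewrite big_cons.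
Qed.

Lemma restr_sum s f : uniq s ->
  restr s f = fun v => \sum_(u <- s) f u * delta u v.
Proof.
move=> us; apply/funext => v; rewrite /restr /delta.
have [vs|vs] := ifPn.
  rewrite (bigD1_seq v)//= eqxx mulr1 big1 ?addr0// => u uv.
  by rewrite eq_sym (negPf uv) mulr0.
rewrite big_seq big1// => u us'; have [vu|_] := eqVneq v u; last by rewrite mulr0.
by rewrite vu us' in vs.
Qed.

Definition norm_ball f e : set (V -> scalars R k) :=
  [set g | space mu X g /\ exists2 M, M < e & bnd (fun v => g v - f v) M].

Lemma open_norm_ball f e : 0 < e -> open_in_space mu X (norm_ball f e).
Proof.
move=> e0; split=> [g []//|g [_ [M Me bM]]].
exists (e - M) => [|h Xh]; first by rewrite subr_gt0.
rewrite wnorm_ltP ?subr_gt0// => -[N Ne bN]; split => //.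
exists (M + N); first by rewrite -ltrBrDl.
by apply: bnd_dom (bndD bM bN) => v; rewrite (addrC (g v - f v)) addrA subrK.
Qed.

Lemma norm_ball_center f e : space mu X f -> 0 < e -> norm_ball f e f.
Proof.
by move=> Xf e0; split => //; exists 0 => //; apply: bnd0 => v; rewrite subrr.
Qed.

(** The radius is halved so that weak bounds, which is what [bnd] expresses, are enough to stay in
    [U]. *)
Lemma open_bnd (U : set (V -> scalars R k)) f : open_in_space mu X U -> U f ->
  exists2 e, 0 < e & forall g, space mu X g -> bnd (fun v => g v - f v) e -> U g.
Proof.
move=> [_ oU] /oU[e e0 Ue]; exists (e / 2) => [|g Xg bg]; first by lra.
by apply: Ue => //; apply/wnorm_ltP => //; exists (e / 2) => //; lra.
Qed.

(** Density of the finitely supported vectors, from [spaceP]. *)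
Lemma open_restr (U : set (V -> scalars R k)) f : open_in_space mu X U -> U f ->
  exists2 s, uniq s & U (restr s f).
Proof.
move=> oU Uf; have Xf : space mu X f by case: oU => /(_ f Uf).
have [e e0 Ue] := open_bnd oU Uf; have /spaceP/(_ e e0)[s bs] := Xf.
exists (undup s); first exact: undup_uniq.
apply: Ue; first exact: space_restr.
apply: bnd_dom bs => v; rewrite /restr /off mem_undup.
by case: ifP; rewrite ?subrr// sub0r modulusN.
Qed.

End weighted_norm.

(** * The backward shift *)

Section unordered_sums.
Variables (R : realType) (k : scalar_kind) (V : choiceType) (A : set V).
Implicit Types (f g : V -> scalars R k) (x y a : scalars R k).

Lemma fsum_fset (F : set V) f : finite_set F ->
  \sum_(u \in F) f u = \sum_(u <- fset_set F) f u.
Proof. by move=> finF; rewrite fsbig_finite. Qed.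

(** Both limits are compared with the partial sum over the union of the two witnessing finite
    sets. *)
Lemma has_sum_unique f x y : has_sum A f x -> has_sum A f y -> x = y.
Proof.
move=> fx fy; apply/eqP; rewrite -subr_eq0 -modulus_eq0; apply/negPn/negP => n0.
have xy0 : 0 < modulus (x - y) / 2.
  by rewrite divr_gt0// lt0r n0 modulus_ge0.
have [F [finF FA] Fx] := fx _ xy0; have [G [finG GA] Gy] := fy _ xy0.
have FG : fsets A (F `|` G) by split; [rewrite finite_setU|rewrite subUset].
have := ltrD (Fx _ FG (@subsetUl _ _ _)) (Gy _ FG (@subsetUr _ _ _)).
set z := \sum_(u \in _) f u; rewrite -splitr ltNge => /negP; apply.
have -> : x - y = (z - y) - (z - x) by ring.
by rewrite (le_trans (modulusB _ _))// addrC.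
Qed.

Lemma sum_overE f x : has_sum A f x -> sum_over A f = x.
Proof.
move=> fx; apply: (has_sum_unique _ fx).
by apply: (@xgetPex _ _ [set s | has_sum A f s]); exists x.
Qed.

Lemma has_sumD f g x y : has_sum A f x -> has_sum A g y ->
  has_sum A (fun v => f v + g v) (x + y).
Proof.
move=> fx gy e e0; have e2 : 0 < e / 2 by lra.
have [F [finF FA] Fx] := fx _ e2; have [G [finG GA] Gy] := gy _ e2.
exists (F `|` G); first by split; [rewrite finite_setU|rewrite subUset].
move=> H HA; rewrite subUset => -[FH GH].
have := ltrD (Fx _ HA FH) (Gy _ HA GH); rewrite -splitr; apply: le_lt_trans.
have finH := proj1 HA.
rewrite !fsum_fset// big_split/= opprD addrACA.
exact: modulusD.
Qed.

Lemma has_sumZ a f x : has_sum A f x -> has_sum A (fun v => a * f v) (a * x).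
Proof.
move=> fx e e0; have a0 := modulus_ge0 a.
have e2 : 0 < e / (modulus a + 1) by rewrite divr_gt0// ltr_wpDl.
have [F FA Fx] := fx _ e2; exists F => // H HA FH; have := Fx _ HA FH.
have finH := proj1 HA.
rewrite !fsum_fset// -mulr_sumr -mulrBr modulusM => h.
rewrite (@le_lt_trans _ _ (modulus a * (e / (modulus a + 1))))//.
  by rewrite ler_wpM2l// ltW.
by rewrite mulrA ltr_pdivrMr ?ltr_wpDl//; lra.
Qed.

End unordered_sums.

(** Membership of [u] in [A] is reflected by a boolean so that the sum has the same form as a value
    of [delta]. *)
Lemma has_sum_delta (R : realType) (k : scalar_kind) (V : countType)
    (A : set V) (u : V) (b : bool) :
  (A u <-> b) -> has_sum A (@delta R k V u) b%:R.
Proof.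
move=> Au e e0; exists (if b then [set u] else set0).
  by case: b Au => Au; split => // v -> /=; apply/Au.
move=> F [finF FA] bF; suff -> : \sum_(v \in F) delta R k u v = b%:R.
  by rewrite subrr modulus0.
have uF : (u \in fset_set F) = b.
  apply/idP/idP => [|bt]; first by rewrite in_fset_set// inE => /FA/Au.
  by rewrite in_fset_set// inE; apply: bF; rewrite bt.
rewrite fsum_fset// /delta; case: b {Au bF} uF => uF.
  rewrite (bigD1_seq u) ?fset_uniq//= eqxx big1 ?addr0// => v /negPf -> //.
rewrite big_seq big1// => v vF; case: eqVneq => // vu.
by rewrite vu uF in vF.
Qed.

(** * Parents and descendants in an unrooted tree *)

Section tree.
Variables (V : countType) (E : rel V).
Hypothesis treeE : directed_tree E.
Hypothesis unrootedE : unrooted E.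
Implicit Types u v : V.

(** Without a root, the dummy value of [par] never occurs, so [par] encodes all edges. *)
Lemma parE u v : E u v = (par E v == u).
Proof.
have Epar : E (par E v) v.
  by apply: (@xgetPex _ _ [set u | E u v]); exact: unrootedE.
by apply/idP/eqP => [/(tree_parent treeE Epar)//|<-].
Qed.

Lemma ChinE n u v : Chin E n v u <-> iter n (par E) u = v.
Proof.
elim: n u v => [|n IH] u v //=; split.
  by move=> [w]; rewrite /Chi /= parE => /eqP <- /IH ->.
move=> <-; exists (iter n (par E) u); last exact/IH.
by rewrite /Chi /= parE.
Qed.

(** A closed orbit of minimal length, reversed because edges run from parent to child, is a circuit.
    Length one is excluded by irreflexivity, circuits having at least two vertices. *)
Lemma par_acyclic n u : iter n.+1 (par E) u != u.
Proof.
apply/eqP => loop.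
have ex : exists m, iter m.+1 (par E) u == u by exists n; apply/eqP.
case: (ex_minnP ex) => -[/eqP/= par1|m /eqP parm minm].
  by have := @tree_irrefl V E treeE u u; rewrite parE par1 eqxx => /(_ erefl).
have := @tree_nocircuit V E treeE (rev (traject (par E) u m.+2)).
rewrite size_rev size_traject => /(_ erefl); rewrite rev_uniq.
have -> : uniq (traject (par E) u m.+2).
  (* If the last point of the orbit equalled an earlier one, of index [i], one more [par] would give
     the return time [i + 1], below the minimal one. *)
  rewrite looping_uniq; apply/trajectP => -[i im loopi].
  have := minm i; rewrite iterS -loopi -iterS parm eqxx => /(_ erefl).
  by rewrite leqNgt im.
move=> /(_ erefl)/negP; apply; rewrite rev_cycle.
rewrite (@eq_cycle _ _ (frel (par E))); last by move=> x y /=; rewrite parE.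
have := fpath_traject (par E) u m.+2.
by rewrite trajectSr -iterSr parm.
Qed.

(** The orbit of [u] hits [v] at most once, since a second visit would close a cycle at [v]; then
    take the maximum over the finitely many pairs. *)
Lemma par_escape (s : seq V) :
  exists m, forall n, (m <= n)%N -> {in s &, forall u v, iter n (par E) u != v}.
Proof.
have one u v : exists m, forall n, (m <= n)%N -> iter n (par E) u != v.
  have [[m mv]|no] := pselect (exists m, iter m (par E) u = v); last first.
    by exists 0%N => n _; apply/eqP => nv; apply: no; exists n.
  exists m.+1 => n mn; rewrite -(subnK mn) addnS -addSn iterD mv.
  exact: par_acyclic.
suff : forall s' : seq (V * V), exists m, forall n, (m <= n)%N ->
    {in s', forall w, iter n (par E) w.1 != w.2}.
  move=> /(_ [seq (u, v) | u <- s, v <- s])[m hm]; exists m => n mn u v us vs.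
  by apply: (hm n mn (u, v)); apply/allpairsP; exists (u, v).
elim=> [|[u v] s' [m hm]]; first by exists 0%N.
have [m' hm'] := one u v; exists (maxn m m') => n; rewrite geq_max => /andP[mn mn'] w.
by rewrite inE => /orP[/eqP -> /=|]; [exact: hm'|exact: hm].
Qed.

End tree.

(** * Iterates of the backward shift: linearity, explicit values, continuity *)

Section shift.
Variables (R : realType) (k : scalar_kind) (V : countType) (E : rel V).
Variables (mu : V -> scalars R k) (X : space_kind R).
Hypothesis treeE : directed_tree E.
Hypothesis unrootedE : unrooted E.
Hypothesis admX : admissible X.
Hypothesis boundedB : Bshift_bounded mu X E.
Implicit Types (f g : V -> scalars R k) (a : scalars R k) (n : nat) (M : R).

Local Notation B := (@Bshift R k V E).
Local Notation bnd := (bnd mu X).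
Local Notation space := (space mu X).
Local Notation delta := (@delta R k V).

Lemma Bshift_has_sum f v : space f -> has_sum (Chi E v) f (B f v).
Proof.
move=> /(proj1 boundedB)[/(_ v)[x fx] _].
by rewrite /Bshift (sum_overE fx).
Qed.

Lemma iter_Bshift_space n f : space f -> space (iter n B f).
Proof. by elim: n => //= n IH /IH/(proj1 boundedB)[]. Qed.

Lemma iter_BshiftD n f g : space f -> space g ->
  iter n B (fun v => f v + g v) = fun v => iter n B f v + iter n B g v.
Proof.
move=> Xf Xg; elim: n => //= n ->; apply/funext => v.
by apply/sum_overE/has_sumD; apply: Bshift_has_sum; apply: iter_Bshift_space.
Qed.

Lemma iter_BshiftZ n a f : space f ->
  iter n B (fun v => a * f v) = fun v => a * iter n B f v.
Proof.
move=> Xf; elim: n => //= n ->; apply/funext => v.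
by apply/sum_overE/has_sumZ; apply: Bshift_has_sum; apply: iter_Bshift_space.
Qed.

Lemma iter_BshiftB n f g : space f -> space g ->
  iter n B (fun v => f v - g v) = fun v => iter n B f v - iter n B g v.
Proof.
move=> Xf Xg.
have -> : (fun v => f v - g v) = (fun v => f v + -1 * g v).
  by apply/funext => v; rewrite mulN1r.
rewrite iter_BshiftD ?iter_BshiftZ//; last exact: spaceZ.
by apply/funext => v; rewrite mulN1r.
Qed.

Lemma iter_Bshift_delta n u : iter n B (delta u) = delta (iter n (par E) u).
Proof.
elim: n => //= n ->; apply/funext => v; apply/sum_overE/has_sum_delta.
by rewrite /Chi /= (parE treeE unrootedE) eq_sym.
Qed.

Lemma iter_Bshift_sum n (s : seq V) (b : V -> scalars R k)
    (G : V -> V -> scalars R k) : {in s, forall u, space (G u)} ->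
  iter n B (fun v => \sum_(u <- s) b u * G u v) =
  fun v => \sum_(u <- s) b u * iter n B (G u) v.
Proof.
elim: s => [|u s IH] sG.
  have -> : (fun v => \sum_(u <- [::]) b u * G u v) = (fun v => 0 * (fun=> 0) v).
    by apply/funext => v; rewrite big_nil mul0r.
  rewrite iter_BshiftZ; last exact: (@space_supp _ _ _ mu X admX [::]).
  by apply/funext => v; rewrite big_nil mul0r.
have Xu := sG u (mem_head _ _).
have Xs v (vs : v \in s) : space (G v) by apply: sG; rewrite inE vs orbT.
transitivity (iter n B (fun v => b u * G u v + \sum_(u <- s) b u * G u v)).
  by congr iter; apply/funext => v; rewrite big_cons.
rewrite iter_BshiftD ?iter_BshiftZ ?IH//; first last.
- exact: space_sum.
- exact: spaceZ.
by apply/funext => v; rewrite big_cons.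
Qed.

(** Since [delta u] is sent to [delta] at the n-th ancestor of [u], the unordered sums become finite
    sums over fibres of the iterated [par]. *)
Lemma iter_Bshift_restr n (s : seq V) f v : uniq s ->
  iter n B (restr s f) v = \sum_(u <- s | iter n (par E) u == v) f u.
Proof.
move=> us; rewrite restr_sum// iter_Bshift_sum => [|u _]; last exact: space_delta.
rewrite [RHS]big_mkcond/=; apply: eq_bigr => u _; rewrite iter_Bshift_delta.
by rewrite /delta eq_sym; case: eqP; rewrite ?mulr1 ?mulr0.
Qed.

Lemma wnorm_ge0 f : (0 <= wnorm mu X f)%E.
Proof.
rewrite /wnorm; case: X => [p|]; first exact: poweR_ge0.
have [v _] := tree_nonempty treeE.
apply: (@le_trans _ _ (modulus (f v * mu v))%:E); first by rewrite lee_fin modulus_ge0.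
by apply: ereal_sup_ubound; exists v.
Qed.

Lemma iter_Bshift_bnd n : exists2 C, 0 <= C &
  forall f M, space f -> bnd f M -> bnd (iter n B f) (C * M).
Proof.
(* No sign is imposed on [C], while bounds have to be non-negative. *)
have [C hC] := proj2 boundedB; pose D := Num.max C 0.
have D0 : 0 <= D by rewrite le_max lexx orbT.
have bB f M : space f -> bnd f M -> bnd (B f) (D * M).
  move=> Xf bf; have M0 := bnd_ge0 bf; apply/(wnorm_leP _ admX); first exact: mulr_ge0.
  apply: le_trans (hC f Xf) _; move/(wnorm_leP mu admX f M0): bf => bf.
  apply: (@le_trans _ _ (D%:E * wnorm mu X f)%E).
    by apply: lee_wpmul2r; [exact: wnorm_ge0|rewrite lee_fin le_max lexx].
  by rewrite EFinM; apply: lee_wpmul2l.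
elim: n => [|n [K K0 hK]]; first by exists 1 => // f M _; rewrite mul1r.
exists (D * K) => [|f M Xf bf]; first exact: mulr_ge0.
by rewrite -mulrA /=; apply: bB; [exact: iter_Bshift_space|exact: hK].
Qed.

Lemma open_iter_preimage n (U : set (V -> scalars R k)) :
  open_in_space mu X U ->
  open_in_space mu X [set f | space f /\ U (iter n B f)].
Proof.
move=> oU; split=> [f []//|f [Xf Uf]].
have [e e0 Ue] := open_bnd admX oU Uf; have [C C0 hC] := iter_Bshift_bnd n.
(* [C + 1] is used because [C] may be 0. *)
exists (e / (C + 1)) => [|g Xg]; first by rewrite divr_gt0// ltr_wpDl.
rewrite wnorm_ltP//; last by rewrite divr_gt0// ltr_wpDl.
move=> [M Me bM]; split => //; apply: Ue; first exact: iter_Bshift_space.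
have Xgf : space (fun v => g v - f v).
  have := spaceD admX Xg (spaceZ admX (-1) Xf).
  by congr (space _); apply/funext => v; rewrite mulN1r.
have := hC _ _ Xgf bM; rewrite iter_BshiftB//; apply: bnd_le => //.
apply: (@le_trans _ _ (C * (e / (C + 1)))); first by rewrite ler_wpM2l// ltW.
by rewrite mulrA ler_pdivrMr ?ltr_wpDl//; lra.
Qed.

End shift.

(** * Duality *)

Section duality.
Variables (R : realType) (k : scalar_kind) (V : countType).
Variables (mu : V -> scalars R k) (X : space_kind R).
Hypothesis weight_mu : is_weight mu.
Hypothesis admX : admissible X.
Implicit Types (A : set V) (r f : V -> scalars R k) (M N p q : R).

Local Notation absmu u := (modulus (mu u)).

Let absmu_gt0 u : 0 < absmu u.
Proof. by rewrite modulus_gt0 weight_mu. Qed.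

(** For [A = Chin E n v], such a vector is a finitely supported preimage of [delta v] under the n-th
    iterate of the shift, of norm at most [M] (see [small_lift]). *)
Definition small A M := exists r (s : seq V),
  [/\ uniq s, {in s, forall u, A u}, \sum_(u <- s) r u = 1 &
      bnd mu X (restr s r) M].

(* [dual_gt A N]: on A, the norm of (1 / mu_u)_u in the dual space is > N. *)
Definition dual_gt A N : Prop :=
  match X with
  | ell p =>
      if p == 1 then exists2 u, A u & N < (absmu u)^-1
      else ((N `^ conj_exp p)%:E <
            \esum_(u in A) ((absmu u `^ conj_exp p)^-1)%:E)%E
  | c0 => (N%:E < \esum_(u in A) ((absmu u)^-1)%:E)%E
  end.

Lemma bnd_restr_ell p (s : seq V) f M : X = ell p -> uniq s -> 0 <= M ->
  \sum_(u <- s) modulus (f u * mu u) `^ p <= M `^ p -> bnd mu X (restr s f) M.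
Proof.
move=> Xp us M0 h; have p0 : 0 < p := admissible_gt0 admX Xp.
rewrite /bnd Xp; split => // t ut; apply: le_trans h.
have -> : \sum_(v <- t) modulus (restr s f v * mu v) `^ p =
    \sum_(v <- t | v \in s) modulus (f v * mu v) `^ p.
  rewrite [RHS]big_mkcond/=; apply: eq_bigr => v _; rewrite /restr.
  by case: ifP => // _; rewrite mul0r modulus0 powR0// gt_eqF.
rewrite -big_filter (perm_big [seq v <- s | v \in t]); last first.
  apply: uniq_perm; rewrite ?filter_uniq// => v.
  by rewrite !mem_filter andbC.
rewrite big_filter big_mkcond/=; apply: ler_sum => v _.
by case: ifP => // _; exact: powR_ge0.
Qed.

Lemma bnd_restr_c0 (s : seq V) f M : X = c0 -> 0 <= M ->
  {in s, forall u, modulus (f u * mu u) <= M} -> bnd mu X (restr s f) M.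
Proof.
move=> Xc M0 h; rewrite /bnd Xc; split => // v; rewrite /restr.
by case: ifP => [/h//|_]; rewrite mul0r modulus0.
Qed.

Lemma conj_exp_gt0 p : 1 < p -> 0 < conj_exp p.
Proof. by move=> p1; rewrite divr_gt0 ?subr_gt0// (lt_trans ltr01). Qed.

Lemma conj_expV p : 1 < p -> p^-1 + (conj_exp p)^-1 = 1.
Proof. by move=> p1; rewrite /conj_exp; field; rewrite !gt_eqF; lra. Qed.

Lemma admissible_gt1 p : X = ell p -> p != 1 -> 1 < p.
Proof.
by move=> Xp p1; move: admX; rewrite Xp /= le_eqVlt eq_sym (negPf p1).
Qed.

(* The extremal vector for Hölder's inequality: r_u proportional to
   |mu_u| ^ (- p* ), with p* = 1 when X = c0. *)
Lemma dual_gt_small A N : 0 < N -> dual_gt A N -> small A N^-1.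
Proof.
move=> N0; rewrite /dual_gt; case XE : X => [p|].
  case: eqVneq => [p1 [u Au Nu]|p1].
    (* For [p = 1] the extremal vector is concentrated at a single vertex. *)
    exists (fun=> 1), [:: u]; split => //.
    - by move=> v; rewrite inE => /eqP ->.
    - by rewrite big_seq1.
    - apply: (bnd_restr_ell XE) => //; first by rewrite invr_ge0 ltW.
      rewrite big_seq1 mul1r p1 !powRr1 ?invr_ge0 ?modulus_ge0 ?(ltW N0)//.
      by rewrite -lef_pV2 ?posrE ?invr_gt0// invrK ltW.
  have {}p1 := admissible_gt1 XE p1; have p0 : 0 < p := lt_trans ltr01 p1.
  set q := conj_exp p; have q0 : 0 < q := conj_exp_gt0 p1.
  move=> /esum_gtP[s [us sA]]; set D := \sum_(u <- s) _ => ND.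
  have D0 : 0 < D by rewrite (le_lt_trans _ ND)// powR_ge0.
  exists (fun u => emb k ((absmu u `^ q)^-1 / D)), s; split => //.
    by rewrite -emb_sum -mulr_suml divff ?gt_eqF// emb1.
  apply: (bnd_restr_ell XE) => //; first by rewrite invr_ge0 ltW.
  (* By this identity, the p-th power of the norm is [D / D ^ p = D ^ (1 - p)]. As [D > N ^ q] and
     [q (p - 1) = p], it is at most [N ^ (- p)]. *)
  have qp : (1 - q) * p = - q by rewrite /q /conj_exp; field; rewrite gt_eqF; lra.
  have -> : \sum_(u <- s) modulus (emb k ((absmu u `^ q)^-1 / D) * mu u) `^ p =
      \sum_(u <- s) (absmu u `^ q)^-1 / D `^ p.
    apply: eq_bigr => u _.
    rewrite modulusM modulus_emb; last first.
      by rewrite divr_ge0 ?invr_ge0 ?powR_ge0 ?(ltW D0).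
    have m0 := absmu_gt0 u; have m0' := ltW m0.
    have -> : (absmu u `^ q)^-1 / D * absmu u = absmu u `^ (1 - q) / D.
      rewrite mulrAC -powRN -{2}(powRr1 m0') -powRD; last first.
        by rewrite (gt_eqF m0) implybT.
      by rewrite addrC.
    have D0' := ltW D0.
    by rewrite powRM ?powR_ge0 ?invr_ge0// powRV// -powRrM qp powRN.
  rewrite -mulr_suml -/D powRV ?(ltW N0)//.
  have -> : D / D `^ p = (D `^ (p - 1))^-1.
    rewrite -powRN -powRN -{1}(powRr1 (ltW D0)) -powRD ?opprB//.
    by rewrite (gt_eqF D0) implybT.
  rewrite lef_pV2 ?posrE ?powR_gt0//.
  have -> : N `^ p = (N `^ q) `^ (p - 1).
    by rewrite -powRrM /q /conj_exp divfK// gt_eqF// subr_gt0.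
  by rewrite powR_leq ?powR_ge0 ?(ltW D0) ?subr_gt0// ltW.
move=> /esum_gtP[s [us sA]]; set D := \sum_(u <- s) _ => ND.
have D0 : 0 < D by rewrite (lt_trans N0).
exists (fun u => emb k ((absmu u)^-1 / D)), s; split => //.
  by rewrite -emb_sum -mulr_suml divff ?gt_eqF// emb1.
apply: (bnd_restr_c0 XE) => [|u _]; first by rewrite invr_ge0 ltW.
rewrite modulusM modulus_emb; last first.
  by apply: divr_ge0; [rewrite invr_ge0 ltW|exact: ltW].
by rewrite mulrAC mulVf ?gt_eqF// mul1r lef_pV2 ?posrE// ltW.
Qed.

(** Hölder's inequality: the coordinates of [r] sum to 1, and this sum is at most [M] times the dual
    norm, which therefore cannot be at most [N]. *)
Lemma small_dual_gt A M N : 0 < N -> M * N < 1 -> small A M -> dual_gt A N.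
Proof.
move=> N0 MN [r [s [us sA r1 b]]]; have M0 := bnd_ge0 b.
(* [M] is replaced by the midpoint of [M] and [1 / N], which is positive, so that one may divide by
   it, and still below [1 / N]. *)
have {}MN : M < N^-1 by rewrite -[N^-1]mul1r ltr_pdivlMr.
have [K0 MK] : 0 < (M + N^-1) / 2 /\ (M + N^-1) / 2 < N^-1 by lra.
have {}b : bnd mu X (restr s r) ((M + N^-1) / 2) by apply: bnd_le b => //; lra.
have {MK}MN : (M + N^-1) / 2 * N < 1 by rewrite -ltr_pdivlMr// mul1r.
move: ((M + N^-1) / 2) K0 MN b => {M0}M Mp MN b; have M0 := ltW Mp; move: b.
have r1' : 1 <= \sum_(u <- s) modulus (restr s r u * mu u) / absmu u.
  rewrite -{1}(modulus1 R k) -r1 (le_trans (modulus_sum _ _ _))//.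
  rewrite big_seq [leRHS]big_seq; apply: ler_sum => u us'.
  by rewrite /restr us' modulusM mulfK// gt_eqF.
rewrite /bnd /dual_gt; case XE : X => [p|] [_ b]; last first.
  apply/esum_gtP; exists s; split => //.
  have : 1 <= M * \sum_(u <- s) (absmu u)^-1.
    apply: le_trans r1' _; rewrite mulr_sumr; apply: ler_sum => u _.
    by rewrite ler_wpM2r ?invr_ge0 ?modulus_ge0.
  set D := \sum_(u <- s) _ => MD; rewrite ltNge; apply/negP => DN.
  have : M * D <= M * N by rewrite ler_wpM2l.
  lra.
case: eqVneq => [p1|p1].
  apply: contrapT => no; have /(_ s us) := b.
  rewrite p1 powRr1// => bM.
  have : 1 <= N * \sum_(u <- s) modulus (restr s r u * mu u).
    apply: le_trans r1' _; rewrite mulr_sumr big_seq [leRHS]big_seq.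
    apply: ler_sum => u us'; rewrite mulrC.
    rewrite ler_wpM2r ?modulus_ge0// leNgt; apply/negP => Nu.
    by apply: no; exists u => //; exact: sA.
  have : N * \sum_(u <- s) modulus (restr s r u * mu u) <= N * M.
    rewrite ler_wpM2l ?(ltW N0)// (le_trans _ bM)//; apply: ler_sum => u _.
    by rewrite powRr1 ?modulus_ge0.
  lra.
have {}p1 := admissible_gt1 XE p1; have p0 : 0 < p := lt_trans ltr01 p1.
set q := conj_exp p; have q0 : 0 < q := conj_exp_gt0 p1.
have pq := conj_expV p1.
rewrite ltNge; apply/negP => /esum_leP/(_ s us sA) dN.
have : \sum_(u <- s) modulus (restr s r u * mu u) / absmu u <= M * N.
  (* Young's inequality for the factors normalised by [M] and [N]; summed over [s], the two parts
     contribute at most [1 / p] and [1 / q], which add up to 1. *)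
  have young u : modulus (restr s r u * mu u) / absmu u <= M * N *
      (modulus (restr s r u * mu u) `^ p / M `^ p / p +
       (absmu u `^ q)^-1 / N `^ q / q).
    have := @conjugate_powR R (modulus (restr s r u * mu u) / M)
      ((absmu u)^-1 / N) p q.
    have x0 := modulus_ge0 (restr s r u * mu u).
    have m0 : 0 <= (absmu u)^-1 by rewrite invr_ge0 modulus_ge0.
    have N0' := ltW N0.
    rewrite powRM ?invr_ge0// powRM ?invr_ge0 ?modulus_ge0// !powRV ?modulus_ge0//.
    move=> /(_ _ _ p0 q0 pq) h.
    rewrite -ler_pdivrMl ?mulr_gt0//.
    apply: le_trans (h _ _); rewrite ?divr_ge0//.
    by rewrite le_eqVlt; apply/orP; left; apply/eqP; field; rewrite !gt_eqF.
  apply: le_trans (ler_sum _ (fun u _ => young u)) _.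
  rewrite -mulr_sumr ler_piMr ?mulr_ge0 ?(ltW N0)//.
  rewrite big_split/= -!mulr_suml -pq lerD// ler_piMl ?invr_ge0 ?(ltW p0) ?(ltW q0)//.
    by rewrite ler_pdivrMr ?powR_gt0// mul1r b.
  by rewrite ler_pdivrMr ?powR_gt0// mul1r.
lra.
Qed.

End duality.

(** * The sets I and J in terms of small vectors *)

Section index_sets.
Variables (R : realType) (k : scalar_kind) (V : countType) (E : rel V).
Variables (mu : V -> scalars R k) (X : space_kind R).
Hypothesis weight_mu : is_weight mu.
Hypothesis admX : admissible X.

Local Notation absmu u := (modulus (mu u)).

Let absmu_gt0 u : 0 < absmu u.
Proof. by rewrite modulus_gt0 weight_mu. Qed.

(** A substitute for the intersection of I and J, with a disjunction in place of the sum in J and a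
    real [e] in place of [1 / N]. The constants lost do not matter, since (3) quantifies over all
    [N]. *)
Definition IJ (s : seq V) (e : R) : set nat :=
  [set n | forall v, v \in s -> small mu X (Chin E n v) e /\
    let w := iter n (par E) v in
    absmu w <= e \/ small mu X (Chin E n w) e].

Lemma IJ_subset (s s' : seq V) (e e' : R) : {subset s <= s'} -> e' <= e ->
  IJ s' e' `<=` IJ s e.
Proof.
have sm A : e' <= e -> small mu X A e' -> small mu X A e.
  move=> ee [r [t [ut tA r1 b]]]; exists r, t; split => //.
  exact: bnd_le b.
move=> ss ee n IJn v /ss/IJn[h1 h2]; split; first exact: sm.
by case: h2 => [h2|/(sm _ ee)]; [left; exact: le_trans h2 _|right].
Qed.

Lemma IsetP (S : set V) N n :
  Iset E mu X S N n <-> forall v, S v -> dual_gt mu X (Chin E n v) N%:R.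
Proof.
suff step v : (match X with
    | ell p => if p == 1 then
          (N%:R%:E < esup0 [set (absmu u)^-1%:E | u in Chin E n v])%E
        else (N%:R%:E < (\esum_(u in Chin E n v) ((absmu u `^ conj_exp p)^-1)%:E)
                       `^ (conj_exp p)^-1)%E
    | c0 => (N%:R%:E < \esum_(u in Chin E n v) ((absmu u)^-1)%:E)%E
    end : Prop) <-> dual_gt mu X (Chin E n v) N%:R.
  by split=> h v /h/step.
rewrite /dual_gt; have := @admissible_gt1 R X admX.
case: X => [p /(_ p erefl) p1|//]; case: eqVneq p1 => [_ _|_ /(_ erefl) p1].
  rewrite /esup0; split=> [/ereal_sup_gt[y []]|[u uv Nu]].
  (* The value 0 adjoined in [esup0] cannot exceed [N]. *)
  - by move=> ->; rewrite lte_fin ltrn0.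
  - by move=> [u uv <-]; rewrite lte_fin; exists u.
  - apply: (@lt_le_trans _ _ ((absmu u)^-1)%:E); first by rewrite lte_fin.
    by apply: ereal_sup_ubound; right; exists u.
rewrite poweR_inv_gt ?conj_exp_gt0// esum_ge0// => u _.
by rewrite lee_fin invr_ge0 powR_ge0.
Qed.

(** If a sum of two terms exceeds its bound, one of them exceeds half of it; this is the source of
    the factor 2. For [p = 1] the minimum is attributed directly to one of its two entries. *)
Lemma Jset_small (S : set V) N n v : (0 < N)%N -> Jset E mu X S N n -> S v ->
  let w := iter n (par E) v in
  absmu w <= 2 / N%:R \/ small mu X (Chin E n w) (2 / N%:R).
Proof.
move=> N0 J Sv w; have := J v Sv; rewrite /= -/w.
have NR : 0 < N%:R :> R by rewrite ltr0n.
have [|wN] := leP (absmu w) (2 / N%:R); first by left.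
move=> h; right; rewrite -invf_div.
apply: dual_gt_small => //; first by rewrite divr_gt0.
have wN' : (absmu w)^-1 < N%:R / 2 by rewrite -invf_div ltf_pV2 ?posrE// divr_gt0.
move: h; rewrite /dual_gt; have := @admissible_gt1 R X admX.
case: X => [p /(_ p erefl) p1|_]; last first.
  apply: contraTT; rewrite -!leNgt => /(leeD2l ((absmu w)^-1)%:E) h.
  by rewrite (le_trans h)// -EFinD lee_fin; lra.
case: eqVneq p1 => [_ _|_ /(_ erefl) p1].
  rewrite gt_min => /orP[|/ereal_inf_lt[y [u uw <-]]]; rewrite lte_fin => h.
    have : 2 / N%:R < N%:R^-1 :> R by exact: lt_trans wN h.
    have : 0 < (N%:R^-1 : R) by rewrite invr_gt0.
    lra.
  exists u => //; have : N%:R < (absmu u)^-1.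
    by rewrite -(invrK N%:R) ltf_pV2 ?posrE ?invr_gt0.
  by apply: le_lt_trans; lra.
set q := conj_exp p; have q0 : 0 < q := conj_exp_gt0 p1.
have q1 : 1 <= q by rewrite /q /conj_exp ler_pdivlMr; lra.
(* Halving [N] inside the power at least halves the bound, because [q >= 1]. *)
have half : 2 * (N%:R / 2) `^ q <= N%:R `^ q.
  have -> : N%:R `^ q = 2 `^ q * (N%:R / 2) `^ q :> R.
    by rewrite -powRM ?divr_ge0// mulrC divfK.
  rewrite ler_wpM2r ?powR_ge0//.
  by apply: le1r_powR => //; rewrite ler1n.
apply: contraTT; rewrite -!leNgt => /(leeD2l ((absmu w `^ q)^-1)%:E) h.
rewrite (le_trans h)// -EFinD lee_fin (le_trans _ half)//.
rewrite mulr_natl mulr2n lerD2r -powRV ?modulus_ge0//.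
rewrite powR_leq// ?invr_ge0 ?modulus_ge0 ?divr_ge0//.
exact: ltW.
Qed.

Lemma small_Jset (S : set V) N n : (0 < N)%N ->
  (forall v, S v -> let w := iter n (par E) v in
     absmu w < N%:R^-1 \/ dual_gt mu X (Chin E n w) N%:R) ->
  Jset E mu X S N n.
Proof.
move=> N0 h v /h /=; set w := iter n _ v => {h}.
have NR : 0 < N%:R :> R by rewrite ltr0n.
have wN : absmu w < N%:R^-1 -> N%:R < (absmu w)^-1.
  by move=> h; rewrite -(invrK N%:R) ltf_pV2 ?posrE ?invr_gt0.
rewrite /dual_gt; have := @admissible_gt1 R X admX.
case: X => [p /(_ p erefl) p1|_]; last first.
  move=> [/wN h|h].
    apply: (@lt_le_trans _ _ ((absmu w)^-1)%:E); first by rewrite lte_fin.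
    by rewrite leeDl// esum_ge0// => u _; rewrite lee_fin invr_ge0 modulus_ge0.
  by apply: lt_le_trans h _; rewrite leeDr// lee_fin invr_ge0 modulus_ge0.
case: eqVneq p1 => [_ _|_ /(_ erefl) p1].
  rewrite gt_min => -[h|[u uw Nu]]; first by rewrite lte_fin h.
  apply/orP; right; apply: (@le_lt_trans _ _ (absmu u)%:E).
    by apply: ereal_inf_lbound; exists u.
  by rewrite lte_fin -(invrK (absmu u)) ltf_pV2 ?posrE ?invr_gt0.
set q := conj_exp p; have q0 : 0 < q := conj_exp_gt0 p1.
move=> [/wN h|h].
  apply: (@lt_le_trans _ _ ((absmu w `^ q)^-1)%:E).
    rewrite lte_fin -powRV ?modulus_ge0//.
    by rewrite gt0_ltr_powR// ?nnegrE ?invr_ge0 ?modulus_ge0.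
  by rewrite leeDl// esum_ge0// => u _; rewrite lee_fin invr_ge0 powR_ge0.
by apply: lt_le_trans h _; rewrite leeDr// lee_fin invr_ge0 powR_ge0.
Qed.

(** [N + 1] makes the product [N / (N + 1)] smaller than 1, as [small_dual_gt] requires, and gives
    the strict bound in J. *)
Lemma IJ_sub_index (s : seq V) N : (0 < N)%N ->
  IJ s (N.+1%:R^-1) `<=` Iset E mu X [set` s] N `&` Jset E mu X [set` s] N.
Proof.
move=> N0 n IJn; have NR : 0 < N%:R :> R by rewrite ltr0n.
have N1 : (N.+1%:R : R)^-1 < N%:R^-1 by rewrite ltf_pV2 ?posrE ?ltr0n// ltr_nat.
have sd A : small mu X A (N.+1%:R^-1) -> dual_gt mu X A N%:R.
  by apply: small_dual_gt => //; rewrite -ltr_pdivlMr// mul1r.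
split; first by apply/IsetP => v /IJn[/sd].
apply: small_Jset => // v /IJn[_ [h|/sd h]]; last by right.
by left; exact: le_lt_trans h N1.
Qed.

Lemma index_sub_IJ (s : seq V) N : (0 < N)%N ->
  Iset E mu X [set` s] N `&` Jset E mu X [set` s] N `<=` IJ s (2 / N%:R).
Proof.
move=> N0 n [/IsetP In Jn] v vs; split; last exact: (Jset_small N0 Jn vs).
have NR : 0 < N%:R :> R by rewrite ltr0n.
have [r [t [ut tA r1 b]]] := dual_gt_small weight_mu admX NR (In v vs).
exists r, t; split => //; apply: bnd_le b => //.
by apply: ler_peMl; [rewrite invr_ge0 ltW|rewrite ler1n].
Qed.

Lemma Iset_Jset_familyP (F : set (set nat)) : Furstenberg F ->
  (forall (N : nat) (S : set V), (0 < N)%N -> finite_set S ->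
     F (Iset E mu X S N `&` Jset E mu X S N)) <->
  (forall s e, 0 < e -> F (IJ s e)).
Proof.
move=> [_ _ Fup]; split=> h.
  (* This [N] exceeds [2 / e], so the bound [2 / N] of [index_sub_IJ] is at most [e]. *)
  move=> s e e0; pose N := (Num.truncn (2 / e)).+1.
  apply: (Fup (Iset E mu X [set` s] N `&` Jset E mu X [set` s] N)).
    exact: h.
  have N0 : (0 < N)%N by [].
  apply: subset_trans (index_sub_IJ N0) _; apply: IJ_subset => //.
  rewrite ler_pdivrMr ?ltr0n// mulrC -ler_pdivrMr//.
  by rewrite ltW// truncnS_gt.
move=> N S N0 /finite_seqP[s ->].
by apply: Fup (IJ_sub_index N0); apply: h; rewrite invr_gt0 ltr0n.
Qed.

End index_sets.

(** * Return sets *)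

Section return_sets.
Variables (R : realType) (k : scalar_kind) (V : countType) (E : rel V).
Variables (mu : V -> scalars R k) (X : space_kind R).
Hypothesis treeE : directed_tree E.
Hypothesis unrootedE : unrooted E.
Hypothesis weight_mu : is_weight mu.
Hypothesis admX : admissible X.
Hypothesis boundedB : Bshift_bounded mu X E.
Implicit Types (U W : set (V -> scalars R k)) (f g : V -> scalars R k).
Implicit Types (s t : seq V) (u v w : V) (n : nat) (e M : R).

Local Notation B := (@Bshift R k V E).
Local Notation bnd := (bnd mu X).
Local Notation space := (space mu X).
Local Notation delta := (@delta R k V).
Local Notation small := (small mu X).
Local Notation IJ := (IJ E mu X).
Local Notation norm_ball := (norm_ball mu X).
Local Notation open_in_space := (open_in_space mu X).
Local Notation par := (par E).

Lemma return_setP U W n :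
  return_set B U W n <-> exists2 f, U f & W (iter n B f).
Proof.
split=> [[_ [[f Uf <-] Wf]]|[f Uf Wf]]; first by exists f.
by exists (iter n B f); split => //; exists f.
Qed.

Lemma open_setI U W : open_in_space U -> open_in_space W ->
  open_in_space (U `&` W).
Proof.
move=> [UX oU] [_ oW]; split=> [f [/UX]//|f [/oU[e e0 Ue] /oW[d d0 Wd]]].
exists (Num.min e d) => [|g Xg]; first by rewrite lt_min e0.
rewrite EFin_min lt_min => /andP[ge gd].
by split; [exact: Ue|exact: Wd].
Qed.

Lemma open_space : open_in_space space.
Proof. by split => // f _; exists 1. Qed.

(** The whole support lies in the fibre over [v], so the image is the total mass 1 placed at [v]. *)
Lemma small_lift n v M : small (Chin E n v) M ->
  exists r, [/\ space r, bnd r M & iter n B r = delta v].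
Proof.
move=> [r [s [us sv r1 b]]]; exists (restr s r); split => //.
  exact: space_restr.
apply/funext => x; rewrite (iter_Bshift_restr treeE unrootedE admX boundedB)// /delta.
have sv' : {in s, forall u, iter n par u = v}.
  by move=> u /sv/(ChinE treeE unrootedE).
rewrite big_seq_cond; have [->|xv] := eqVneq.
  rewrite -r1 [RHS]big_seq; apply: eq_bigl => u.
  by case us' : (u \in s) => //=; rewrite sv' ?eqxx.
by rewrite big1// => u /andP[/sv' ->]; rewrite eq_sym (negPf xv).
Qed.

Lemma small_kill n v M : 0 <= M ->
  (let w := iter n par v in
    modulus (mu w) <= M \/ small (Chin E n w) M) ->
  exists r, [/\ space r, bnd (fun x => r x - delta v x) M & bnd (iter n B r) M].
Proof.
move=> M0 /=; set w := iter n par v => -[wM|/small_lift[r [Xr br Br]]].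
  exists (delta v); split; first exact: space_delta.
    by apply: (bnd_le admX M0); apply: bnd0 => // x; rewrite subrr.
  rewrite (iter_Bshift_delta R k treeE unrootedE).
  have := bnd_deltaZ mu admX 1 w; rewrite mul1r => /(bnd_le admX wM).
  by apply: bnd_dom => // x; rewrite mul1r.
have Xd := space_delta mu admX v.
exists (fun x => delta v x + -1 * r x); split.
- by apply: spaceD => //; exact: spaceZ.
- by apply: bnd_dom br => // x; rewrite addrC addrA addNr add0r mulN1r modulusN.
- rewrite (iter_BshiftD boundedB)//; last exact: spaceZ.
  rewrite (iter_BshiftZ boundedB)// Br (iter_Bshift_delta R k treeE unrootedE).
  by apply: (bnd_le admX M0); apply: bnd0 => // x; rewrite mulN1r subrr.
Qed.

(* The witness is f, minus a small vector with the same image under B^n wherever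
   that image is not small already, plus a small preimage of g. *)
Lemma IJ_sub_return U W : open_in_space U -> U !=set0 ->
  open_in_space W -> W !=set0 ->
  exists s e, 0 < e /\ IJ s e `<=` return_set B U W.
Proof.
move=> oU [f0 Uf0] oW [g0 Wg0].
have [s us Uf] := open_restr admX oU Uf0.
have [t ut Wg] := open_restr admX oW Wg0.
have [e1 e10 Ue] := open_bnd admX oU Uf; have [e2 e20 We] := open_bnd admX oW Wg.
(* Each unit of coefficient in [f0] or [g0] costs an error [e], so the total error is at most
   [K * e]. The [+ 1] in [e] covers [K = 0]. *)
pose K := \sum_(u <- s) modulus (f0 u) + \sum_(u <- t) modulus (g0 u).
have Kf0 : 0 <= \sum_(u <- s) modulus (f0 u).
  by apply: sumr_ge0 => *; exact: modulus_ge0.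
have Kg0 : 0 <= \sum_(u <- t) modulus (g0 u).
  by apply: sumr_ge0 => *; exact: modulus_ge0.
have K0 : 0 <= K by exact: addr_ge0.
pose m := Num.min e1 e2; have m0 : 0 < m by rewrite lt_min e10.
pose e := m / (K + 1); have e0 : 0 < e by rewrite divr_gt0// ltr_wpDl.
have Ke : K * e <= m.
  by rewrite /e mulrA ler_pdivrMr ?ltr_wpDl//; have := ltW m0; nra.
have me1 : m <= e1 by rewrite ge_min lexx.
have me2 : m <= e2 by rewrite ge_min lexx orbT.
exists (s ++ t), e; split => // n IJn; apply/return_setP.
have /choice[D hD] : forall v, exists r, v \in s -> [/\ space r,
    bnd (fun x => r x - delta v x) e & bnd (iter n B r) e].
  move=> v; have [vs|vs] := boolP (v \in s); last by exists (fun=> 0).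
  have [|_ /(small_kill (ltW e0))[r hr]] := IJn v; first by rewrite mem_cat vs.
  by exists r.
have /choice[P hP] : forall v, exists r, v \in t -> [/\ space r,
    bnd r e & iter n B r = delta v].
  move=> v; have [vt|vt] := boolP (v \in t); last by exists (fun=> 0).
  have [|/small_lift[r hr] _] := IJn v; first by rewrite mem_cat vt orbT.
  by exists r.
(* [hf] replaces each [delta u] in the expansion of [f0] by a nearby vector with small image; [hg]
   replaces those of [g0] by small preimages. *)
pose hf x := \sum_(u <- s) f0 u * D u x; pose hg x := \sum_(u <- t) g0 u * P u x.
have Xhf : space hf by apply: space_sum => // u /hD[].
have Xhg : space hg by apply: space_sum => // u /hP[].
have Bhf : bnd (iter n B hf) (\sum_(u <- s) modulus (f0 u) * e).
  rewrite (iter_Bshift_sum admX boundedB)//; last by move=> u /hD[].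
  by rewrite -mulr_suml; apply: bnd_sum => //; [exact: ltW|move=> u /hD[]].
have Bhg : iter n B hg = restr t g0.
  rewrite (iter_Bshift_sum admX boundedB)//; last by move=> u /hP[].
  rewrite restr_sum//; apply/funext => x; rewrite !big_seq.
  by apply: eq_bigr => u /hP[_ _ ->].
exists (fun x => hf x + hg x).
  apply: Ue; first exact: spaceD.
  have b1 : bnd (fun x => \sum_(u <- s) f0 u * (D u x - delta u x))
      (\sum_(u <- s) modulus (f0 u) * e).
    by rewrite -mulr_suml; apply: bnd_sum => //; [exact: ltW|move=> u /hD[]].
  have b2 : bnd hg (\sum_(u <- t) modulus (g0 u) * e).
    by rewrite -mulr_suml; apply: bnd_sum => //; [exact: ltW|move=> u /hP[]].
  have := bndD admX b1 b2; rewrite -!mulr_suml -mulrDl => b.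
  apply: (bnd_le admX (le_trans Ke me1)); apply: bnd_dom b => // x.
  under [X in _ <= modulus (X + _)]eq_bigr do rewrite mulrBr.
  by rewrite sumrB restr_sum// addrAC.
apply: We; first by apply: iter_Bshift_space => //; exact: spaceD.
rewrite (iter_BshiftD boundedB)// Bhg.
apply: (@bnd_le _ _ _ _ _ admX _ (\sum_(u <- s) modulus (f0 u) * e)).
  by rewrite -mulr_suml (le_trans _ (le_trans Ke me2))// ler_wpM2r ?(ltW e0)// lerDl.
by apply: bnd_dom Bhf => // x; rewrite addrK.
Qed.

(** With [2 * d <= modulus (mu v)], an error of norm [d] changes the coordinate at [v] by at most
    1/2; with [2 * d <= e], a vector of norm [d] may be divided by a scalar of modulus at least
    1/2. *)
Lemma uniform_radius s e : 0 < e -> exists d,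
  [/\ 0 < d, 2 * d <= e & {in s, forall v, 2 * d <= modulus (mu v)}].
Proof.
move=> e0; elim: s => [|u s [d [d0 de ds]]].
  by exists (e / 2); split => //; [lra|rewrite mulrC divfK].
have u0 : 0 < modulus (mu u) by rewrite modulus_gt0 weight_mu.
exists (Num.min d (modulus (mu u) / 2)); split.
- by rewrite lt_min d0 divr_gt0.
- by apply: le_trans de; rewrite ler_wpM2l// ge_min lexx.
- move=> v; rewrite inE => /orP[/eqP ->|/ds]; last first.
    by apply: le_trans; rewrite ler_wpM2l// ge_min lexx.
  by rewrite -ler_pdivlMl// mulrC ge_min lexx orbT.
Qed.

Definition ind s : V -> scalars R k := restr s (fun=> 1).

(** Dividing [h] by the value of its image at [x] normalises the mass over the fibre of [x] to 1 and
    at most doubles the norm. *)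
Lemma Bshift_large_small t h n x d : uniq t -> bnd (restr t h) d ->
  1 / 2 <= modulus (iter n B (restr t h) x) -> small (Chin E n x) (2 * d).
Proof.
move=> ut bh; set b := iter n B _ x => b2; have d0 := bnd_ge0 bh.
have b0 : 0 < modulus b by rewrite (lt_le_trans _ b2)// divr_gt0.
exists (fun u => b^-1 * restr t h u), [seq u <- t | iter n par u == x]; split.
- exact: filter_uniq.
- by move=> u; rewrite mem_filter => /andP[/eqP ux _]; apply/(ChinE treeE unrootedE).
- rewrite -mulr_sumr big_filter.
  have -> : \sum_(u <- t | iter n par u == x) restr t h u = b.
    rewrite /b (iter_Bshift_restr treeE unrootedE admX boundedB)//.
    rewrite big_seq_cond [RHS]big_seq_cond; apply: eq_bigr => u /andP[ut' _].
    by rewrite /restr ut'.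
  by rewrite mulVf// -modulus_gt0.
- have := bndZ admX b^-1 bh; rewrite modulusV => b'.
  have /(bnd_le admX) : (modulus b)^-1 * d <= 2 * d.
    by rewrite ler_wpM2r// -(invrK 2) lef_pV2 ?posrE// -[2^-1]mul1r.
  move=> /(_ _ _ _ _ b'); apply: bnd_dom => // v.
  by rewrite {1}/restr; case: ifP => // _; rewrite modulus0 modulus_ge0.
Qed.

(* Both [a = -1] and the escape condition keep |a - c| >= 1 for every
   c = #{u in s | par^n u = x}, x in s, so that nothing can cancel. *)
Lemma return_ball_IJ s e : uniq s -> 0 < e -> exists2 d, 0 < d &
  forall n (a : scalars R k) f,
    a = -1 \/ a = 1 /\ {in s &, forall u v, iter n par u != v} ->
    space f -> bnd (fun x => f x - ind s x) d ->
    bnd (fun x => iter n B f x - a * ind s x) d ->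
    (exists2 t, uniq t & f = restr t f) -> IJ s e n.
Proof.
move=> us e0; have [d [d0 de ds]] := uniform_radius s e0; exists d => //.
move=> n a f ha Xf bf bBf [t ut ft].
(* [T] carries both [f] and [ind s], so the image of the small vector [h] is given by finite
   sums. *)
pose T := undup (t ++ s); pose h x := f x - ind s x.
have Xs : space (ind s) by apply: space_restr.
have hT : restr T h = h.
  apply/funext => x; rewrite {1}/restr mem_undup mem_cat.
  case: ifPn => //; rewrite negb_or => /andP[/negPf xt /negPf xs].
  by rewrite /h ft /ind /restr xs xt subrr.
have Bh x : iter n B h x = iter n B f x - iter n B (ind s) x.
  by rewrite (iter_BshiftB admX boundedB).
pose c x := count (fun u => iter n par u == x) s.
have Bi x : iter n B (ind s) x = (c x)%:R.
  rewrite (iter_Bshift_restr treeE unrootedE admX boundedB)//.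
  by rewrite /c -sum1_count natr_sum.
have sm x : 1 / 2 <= modulus (iter n B h x) -> small (Chin E n x) e.
  move=> hx; have : small (Chin E n x) (2 * d).
    by apply: (@Bshift_large_small T h); rewrite ?undup_uniq ?hT.
  by move=> [r [q [? ? ? ?]]]; exists r, q; split => //; exact: (bnd_le admX de).
have inds x : x \in s -> ind s x = 1 by rewrite /ind /restr => ->.
have ac x : x \in s -> 1 <= modulus (a - (c x)%:R).
  move=> xs; case: ha => [->|[-> esc]].
    by rewrite -opprD modulusN addrC natr1 modulus_nat ler1n.
  have -> : c x = 0%N; last by rewrite subr0 modulus1.
  apply/eqP; rewrite -leqn0 leqNgt -has_count -all_predC.
  by apply/allP => u us' /=; exact: esc.
(* On [s] the image of [f] is within 1/2 of [a], which is at distance at least 1 from [c x]; hence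
   the image of [h] has modulus at least 1/2. *)
have smI x : x \in s -> small (Chin E n x) e.
  move=> xs; apply: sm; rewrite Bh Bi.
  have := bnd_coord admX x bBf; rewrite inds// mulr1 => bx.
  have mx := ds x xs.
  have ax : modulus (iter n B f x - a) <= 1 / 2.
    rewrite -(ler_pM2r (_ : 0 < modulus (mu x))); last by lra.
    by rewrite (le_trans bx)//; lra.
  have -> : iter n B f x - (c x)%:R = (a - (c x)%:R) - (a - iter n B f x).
    by rewrite opprB [RHS]addrC addrA subrK.
  have := ler_modulusB (a - (c x)%:R) (a - iter n B f x).
  rewrite -(modulusN (a - iter n B f x)) opprB.
  by have := ac x xs; lra.
move=> v vs; split => /=; first exact: smI.
set w := iter n par v; have [ws|ws] := boolP (w \in s); first by right; exact: smI.
have := bnd_coord admX w bBf.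
have -> : ind s w = 0 by rewrite /ind /restr (negPf ws).
rewrite mulr0 subr0 => bw.
(* Outside [s] the image of [f] at [w] has weighted size at most [d]. Either its modulus is at least
   1/2 and the weight at [w] is small, or it is below 1/2 while [c w >= 1], as [v] is counted, so
   the image of [h] is large. *)
have [Bw|Bw] := leP (1 / 2) (modulus (iter n B f w)).
  left; apply: le_trans de; have mw := modulus_ge0 (mu w).
  by have := ler_wpM2r mw Bw; lra.
right; apply: sm; rewrite Bh Bi -modulusN opprB.
have := ler_modulusB ((c w)%:R) (iter n B f w); rewrite modulus_nat.
have : (1 : R) <= (c w)%:R.
  by rewrite ler1n -has_count; apply/hasP; exists v => //=.
by lra.
Qed.

(** By continuity, the vectors of the first ball whose image lies in the second form an open set, so
    a finitely supported one exists and [return_ball_IJ] applies. *)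
Lemma return_sub_IJ s e : uniq s -> 0 < e -> exists2 d, 0 < d &
  forall n (a : scalars R k),
    a = -1 \/ a = 1 /\ {in s &, forall u v, iter n par u != v} ->
    return_set B (norm_ball (ind s) d) (norm_ball (fun x => a * ind s x) d) n ->
    IJ s e n.
Proof.
move=> us e0; have [d d0 hd] := return_ball_IJ us e0; exists d => // n a ha.
move=> /return_setP[f Uf Wf].
have oW : open_in_space [set f | space f /\
    norm_ball (fun x => a * ind s x) d (iter n B f)].
  by apply: open_iter_preimage => //; exact: open_norm_ball.
have oU := open_norm_ball mu admX (ind s) d0.
have [|t ut] := open_restr admX (open_setI oU oW) (f := f).
  by split => //; split => //; case: Uf.
move=> [[Xf [M Md bM]] [_ [_ [N Nd bN]]]].
apply: (hd n a (restr t f)) => //.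
- exact: (bnd_le admX (ltW Md)).
- exact: (bnd_le admX (ltW Nd)).
- by exists t => //; apply/funext => x; rewrite /restr; case: ifP.
Qed.

End return_sets.

(** * The implications between the four conditions *)

Section equivalences.
Variables (R : realType) (k : scalar_kind) (V : countType) (E : rel V).
Variables (mu : V -> scalars R k) (X : space_kind R).
Variable F : set (set nat).
Hypothesis treeE : directed_tree E.
Hypothesis unrootedE : unrooted E.
Hypothesis weight_mu : is_weight mu.
Hypothesis furstenbergF : Furstenberg F.
Hypothesis admX : admissible X.
Hypothesis boundedB : Bshift_bounded mu X E.

Local Notation B := (@Bshift R k V E).
Local Notation space := (space mu X).
Local Notation IJ := (IJ E mu X).
Local Notation open_in_space := (open_in_space mu X).
Local Notation par := (par E).
Local Notation IJ_family := (forall s e, 0 < e -> F (IJ s e)).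

Lemma Ftilde_sub : Ftilde F `<=` F.
Proof.
case: furstenbergF => _ _ up A /(_ 0%N)[D FD DA]; apply: up FD _ => n Dn.
by apply: DA; exists n, 0; split => //=; rewrite addr0.
Qed.

Lemma space_ind s : space (ind R k s).
Proof. exact: space_restr. Qed.

Lemma transitive_IJ : transitive_for mu X B F -> IJ_family.
Proof.
move=> trB s e e0; case: furstenbergF => _ _ up.
have [d d0 hd] := return_sub_IJ treeE unrootedE weight_mu admX boundedB
  (undup_uniq s) e0.
have Xs := space_ind (undup s); have XNs := spaceZ admX (-1) Xs.
have := trB _ _
  (open_norm_ball mu admX _ d0) (ex_intro _ _ (norm_ball_center admX Xs d0))
  (open_norm_ball mu admX _ d0) (ex_intro _ _ (norm_ball_center admX XNs d0)).
move=> /up; apply => n /(hd n (-1) (or_introl erefl)).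
by apply: (IJ_subset admX) => // v; rewrite mem_undup.
Qed.

Lemma recurrent_IJ :
  (forall (A : set nat) n, (0 < n)%N -> F A -> F (A `&` [set m | (n <= m)%N])) ->
  recurrent_for mu X B F -> IJ_family.
Proof.
move=> cutF recB s e e0; case: furstenbergF => _ _ up.
have [d d0 hd] := return_sub_IJ treeE unrootedE weight_mu admX boundedB
  (undup_uniq s) e0.
have Xs := space_ind (undup s).
have [m hm] := par_escape treeE unrootedE (undup s).
have := recB _
  (open_norm_ball mu admX _ d0) (ex_intro _ _ (norm_ball_center admX Xs d0)).
(* The cut is at [m + 1] because the hypothesis on [F] concerns positive integers only, and [m] may
   be 0. *)
move=> /(cutF _ m.+1 isT)/up; apply => n [nU /ltnW/hm esc].
apply: (@IJ_subset _ _ _ _ _ _ admX _ (undup s) e e) => //.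
  by move=> v; rewrite mem_undup.
apply: (hd n 1); first by right.
by congr (return_set _ _ (norm_ball _ _ _ _) _): nU; apply/funext => x; rewrite mul1r.
Qed.

Lemma IJ_transitive : IJ_family -> transitive_for mu X B F.
Proof.
move=> IJF U W oU U0 oW W0; case: furstenbergF => _ _ up.
have [s [e [e0 se]]] :=
  IJ_sub_return treeE unrootedE admX boundedB oU U0 oW W0.
by apply: up se; exact: IJF.
Qed.

(** Members of [F] are infinite, so some orbit enters [U] at a time [n >= j]; its point at time
    [n - j] is the one sought. *)
Lemma preimage_nonempty U j : transitive_for mu X B F ->
  open_in_space U -> U !=set0 -> [set f | space f /\ U (iter j B f)] !=set0.
Proof.
move=> trB oU U0; case: furstenbergF => _ inf _.
have Xtriv : space !=set0 by exists (ind R k [::]); exact: space_ind.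
have /inf infN := trB _ _ (open_space mu X) Xtriv oU U0.
have [n [jn /return_setP[f Xf Uf]]] : exists n, (j <= n)%N /\
    return_set B space U n.
  apply: contrapT => no; apply: infN; apply: sub_finite_set (finite_II j) => n Nn.
  by rewrite /= ltnNge; apply/negP => jn; apply: no; exists n.
exists (iter (n - j)%N B f); split; first exact: iter_Bshift_space.
by rewrite -iterD subnKC.
Qed.

(** A single set [IJ s e] has to work for all shifts up to [N]. Time [n + j] is reached by replacing
    [W] with its preimage under the j-th iterate, time [n - j] by replacing [U] with its
    preimage. *)
Lemma IJ_transitive_tilde : IJ_family -> transitive_for mu X B (Ftilde F).
Proof.
move=> IJF U W oU U0 oW W0 N; have trB := IJ_transitive IJF.
have [s [e [e0 se]]] : exists s e, 0 < e /\ forall n, IJ s e n ->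
    forall j, (j <= N)%N -> return_set B U W (n + j)%N /\
      ((j <= n)%N -> return_set B U W (n - j)%N).
  have step j : exists s e, 0 < e /\ forall n, IJ s e n ->
      return_set B U W (n + j)%N /\ ((j <= n)%N -> return_set B U W (n - j)%N).
    have oUj := open_iter_preimage treeE admX boundedB j oU.
    have oWj := open_iter_preimage treeE admX boundedB j oW.
    have [s1 [e1 [e10 h1]]] := IJ_sub_return treeE unrootedE admX boundedB
      oU U0 oWj (preimage_nonempty j trB oW W0).
    have [s2 [e2 [e20 h2]]] := IJ_sub_return treeE unrootedE admX boundedB
      oUj (preimage_nonempty j trB oU U0) oW W0.
    exists (s1 ++ s2), (Num.min e1 e2); split; first by rewrite lt_min e10.
    move=> n IJn; split=> [|jn].
      have /h1/return_setP[f Uf [_ Wf]] : IJ s1 e1 n.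
        apply: (IJ_subset admX _ _ IJn) => // [v|]; first by rewrite mem_cat => ->.
        by rewrite ge_min lexx.
      by apply/return_setP; exists f => //; rewrite addnC iterD.
    have /h2/return_setP[f [_ Uf] Wf] : IJ s2 e2 n.
      apply: (IJ_subset admX _ _ IJn) => // [v|]; first by rewrite mem_cat orbC => ->.
      by rewrite ge_min lexx orbT.
    by apply/return_setP; exists (iter j B f) => //; rewrite -iterD subnK.
  elim: N => [|N [s1 [e1 [e10 h1]]]].
    have [s [e [e0 h]]] := step 0%N; exists s, e; split => // n /h h' j.
    by rewrite leqn0 => /eqP ->.
  have [s2 [e2 [e20 h2]]] := step N.+1.
  exists (s1 ++ s2), (Num.min e1 e2); split; first by rewrite lt_min e10.
  move=> n IJn j; rewrite leq_eqVlt => /orP[/eqP ->|jN].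
    apply: h2; apply: (IJ_subset admX _ _ IJn) => // [v|].
      by rewrite mem_cat orbC => ->.
    by rewrite ge_min lexx orbT.
  apply: h1 => //; apply: (IJ_subset admX _ _ IJn) => // [v|].
    by rewrite mem_cat => ->.
  by rewrite ge_min lexx.
exists (IJ s e); first exact: IJF.
move=> m [n [j [IJn /andP[jN Nj] mE]]]; have {}se := se n IJn.
case: j jN Nj mE => [j|j] jN Nj mE.
  have -> : m = (n + j)%N by apply/eqP; rewrite -eqz_nat mE PoszD.
  by apply: (se j _).1; rewrite -lez_nat.
(* Since [m] is a natural number, a negative shift cannot exceed [n] in absolute value. *)
have jn : (j.+1 <= n)%N by rewrite -lez_nat -subr_ge0; move: mE; rewrite NegzE => <-.
have -> : m = (n - j.+1)%N.
  by apply/eqP; rewrite -eqz_nat mE NegzE -subzn.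
by apply: (se j.+1 _).2 => //; rewrite -lez_nat -lerN2 -NegzE.
Qed.

End equivalences.

Theorem theorem5p1 (R : realType) (k : scalar_kind) (V : countType)
    (E : rel V) (mu : V -> scalars R k) (F : set (set nat))
    (X : space_kind R)
    (treeE : directed_tree E) (unrootedE : unrooted E)
    (weight_mu : is_weight mu) (furstenbergF : Furstenberg F)
    (admX : admissible X) (boundedB : Bshift_bounded mu X E) :
  let B := @Bshift R k V E in
  let cond1 := transitive_for mu X B (Ftilde F) in
  let cond2 := transitive_for mu X B F in
  let cond3 := forall (N : nat) (S : set V), (0 < N)%N -> finite_set S ->
                 F (Iset E mu X S N `&` Jset E mu X S N) in
  let cond4 := recurrent_for mu X B F in
  (cond1 <-> cond2) /\ (cond2 <-> cond3) /\
  ((forall (A : set nat) (n : nat), (0 < n)%N -> F A ->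
      F (A `&` [set m | (n <= m)%N])) ->
   cond3 <-> cond4).
Proof.
move=> B cond1 cond2 cond3 cond4.
have cond3P : cond3 <-> forall s e, (0 < e)%R -> F (IJ E mu X s e).
  exact: Iset_Jset_familyP.
have c12 : cond1 -> cond2.
  by move=> c1 U W oU U0 oW W0; apply: Ftilde_sub => //; exact: c1.
have c23 : cond2 -> cond3 by move=> c2; apply/cond3P; exact: transitive_IJ.
have c31 : cond3 -> cond1 by move=> /cond3P; exact: IJ_transitive_tilde.
split; first by split=> [//|/c23/c31].
split; first by split=> [//|/c31/c12].
move=> cutF; split=> [/c31/c12 c2 U oU U0|c4]; first exact: c2.
by apply/cond3P; exact: recurrent_IJ.
Qed.
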